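(* Assume that the semifilter trichotomy holds. Let $X\subseteq[\omega]^\omega$. Then the following statements are equivalent. (1) The set $X\cup\mathrm{Fin}$ is $\mathfrak b$-concentrated on $\mathrm{Fin}$. (2) The set $X\cup\mathrm{Fin}$ is $\mathfrak b$-concentrated on $\mathrm{Fin}$ and Hurewicz. (3) The set $X\cup\mathrm{Fin}$ is $\mathfrak b$-concentrated on $\mathrm{Fin}$ and it is productively Hurewicz. (4) The set $X$ is meager-unbounded.
   Context: $P(\omega)$ is the power set of $\omega$ with the topology obtained by identifying subsets of $\omega$ with their characteristic functions in the Cantor cube $2^\omega$. $[\omega]^\omega$ is the set of infinite subsets of $\omega$ and $\mathrm{Fin}$ the set of finite subsets of $\omega$. Each element of $[\omega]^\omega$ is identified with its increasing enumeration, so $[\omega]^\omega$ is viewed as a subset of $\omega^\omega$. For $a,b\in\omega^\omega$, $a\le^* b$ means $a(n)\le b(n)$ for all but finitely many $n$; $\mathfrak b$ is the minimal cardinality of a subset of $\omega^\omega$ that has no $\le^*$-upper bound in $\omega^\omega$. A set of reals is an infinite topological space homeomorphic to a subspace of $2^\omega$. A space $X$ is Hurewicz if for each sequence $\mathcal U_0,\mathcal U_1,\dots$ of open covers of $X$ there are finite sets $\mathcal F_n\subseteq\mathcal U_n$ such that for each $x\in X$ the set $\{n: x\in\bigcup\mathcal F_n\}$ is cofinite. A set of reals $X$ is productively Hurewicz if for each Hurewicz set of reals $Y$ the product space $X\times Y$ is Hurewicz. For an infinite cardinal $\kappa$, a set $Y$ is $\kappa$-concentrated on a set $D\subseteq Y$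 if $|Y|\ge\kappa$ and $|Y\setminus U|<\kappa$ for each open set $U$ containing $D$. A nonempty set $S\subseteq[\omega]^\omega$ is a semifilter if for all $a\in S$ and $b\in[\omega]^\omega$ with $a\setminus b$ finite we have $b\in S$. It is meager if it is a meager subset of $[\omega]^\omega$. For $a,b\in[\omega]^\omega$, $a\le_S b$ means $\{n: a(n)\le b(n)\}\in S$. A set $X\subseteq[\omega]^\omega$ is meager-unbounded if $|X|\ge\mathfrak b$ and for each $b\in[\omega]^\omega$ there are a meager semifilter $S(b)$ and a set $A\subseteq X$ of size smaller than $\mathfrak b$ such that $b\le_{S(b)}x$ for all $x\in X\setminus A$. For $x,h\in[\omega]^\omega$ and $S\subseteq[\omega]^\omega$ let $x/h:=\{n\in\omega: x\cap[h(n),h(n+1))\ne\emptyset\}$ and $S/h:=\{x/h: x\in S\}$. The semifilter trichotomy is the statement that for every semifilter $S\subseteq[\omega]^\omega$ there is $h\in[\omega]^\omega$ such that $S/h$ is the Fréchet filter of all cofinite subsets of $\omega$, or an ultrafilter (contained in $[\omega]^\omega$, i.e. nonprincipal), or the full semifilter $[\omega]^\omega$. *)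

(* Defs.v *)
From HB Require Import structures.
From mathcomp Require Import all_boot all_order all_algebra.
From mathcomp Require Import all_classical all_reals all_analysis.

Set Implicit Arguments.
Unset Strict Implicit.
Unset Printing Implicit Defensive.

Local Open Scope classical_set_scope.
Local Open Scope card_scope.

(* Cardinals are represented by sets having that cardinality. *)
Definition card_lt T U (A : set T) (B : set U) : Prop :=
  A #<= B /\ ~ (B #<= A).

Definition le_star (f g : nat -> nat) : Prop :=
  \forall n \near \oo, (f n <= g n)%N.

Definition le_star_unbounded (B : set (nat -> nat)) : Prop :=
  ~ exists g, forall f, B f -> le_star f g.

Definition min_unbounded (B : set (nat -> nat)) : Prop :=
  le_star_unbounded B /\
  forall C : set (nat -> nat), le_star_unbounded C -> B #<= C.

(* The cardinal b is represented by a chosen unbounded family of minimal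
   cardinality; such a family exists by [min_unbounded_bb] below. *)
Definition bb : set (nat -> nat) := xget set0 min_unbounded.

(* [initial_topology f] is the domain of [f] with the topology induced by [f],
   so P(omega) is [set nat] with the topology of the Cantor cube transported
   along characteristic functions. *)
Definition charf (a : set nat) : cantor_space := fun n => `[< a n >].

Definition Pomega : Type := initial_topology charf.
HB.instance Definition _ := Topological.on Pomega.

Definition infsets : set Pomega := [set a | infinite_set (a : set nat)].
Definition Fin : set Pomega := [set a | finite_set (a : set nat)].

Definition is_enum (a : set nat) (f : nat -> nat) : Prop :=
  {homo f : m n / (m < n)%N} /\ range f = a.

(* The increasing enumeration of an infinite set; see [is_enum_enumeration]. *)
Definition enumeration (a : set nat) : nat -> nat :=
  @xget (nat -> nat) id (is_enum a).

(* A subset [A] of a space [T], viewed as a type, carries the subspace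
   topology (library file subtype_topology), not the topology of [subspace]. *)

Definition homeomorphic (S T : topologicalType) : Prop :=
  exists (f : S -> T) (g : T -> S),
    [/\ continuous f, continuous g, cancel f g & cancel g f].

Definition set_of_reals (T : topologicalType) : Prop :=
  infinite_set [set: T] /\
  exists A : set cantor_space, homeomorphic T (set_type A).

Definition open_cover (T : topologicalType) (U : set (set T)) : Prop :=
  U `<=` open /\ \bigcup_(V in U) V = setT.

Definition hurewicz (T : topologicalType) : Prop :=
  forall U : nat -> set (set T), (forall n, open_cover (U n)) ->
  exists F : nat -> set (set T),
    (forall n, finite_set (F n) /\ F n `<=` U n) /\
    forall x : T, \forall n \near \oo, (\bigcup_(V in F n) V) x.

Definition productively_hurewicz (T : topologicalType) : Prop :=
  forall Y : topologicalType, set_of_reals Y -> hurewicz Y ->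
    hurewicz (T * Y)%type.

Definition concentrated U (K : set U) (T : topologicalType) (Y D : set T) :
    Prop :=
  [/\ D `<=` Y, K #<= Y &
    forall V : set T, open V -> D `<=` V -> card_lt (Y `\` V) K].

Definition nowhere_dense (T : topologicalType) (A : set T) : Prop :=
  interior (closure A) = set0.

Definition meager (T : topologicalType) (A : set T) : Prop :=
  exists F : nat -> set T, (forall n, nowhere_dense (F n)) /\
    A = \bigcup_n F n.

Definition semifilter (S : set Pomega) : Prop :=
  [/\ S !=set0, S `<=` infsets &
    forall a b : set nat, S a -> infsets b -> finite_set (a `\` b) -> S b].

(* Meagerness is relative to the space of infinite sets, not to [Pomega]. *)
Definition meager_semifilter (S : set Pomega) : Prop :=
  semifilter S /\ meager [set a : set_type infsets | S (set_val a)].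

Definition le_semi (S : set Pomega) (a b : set nat) : Prop :=
  S [set n | (enumeration a n <= enumeration b n)%N].

Definition meager_unbounded (X : set Pomega) : Prop :=
  bb #<= X /\
  forall b, infsets b -> exists (S A : set Pomega),
    [/\ meager_semifilter S, A `<=` X, card_lt A bb &
      forall x, (X `\` A) x -> le_semi S b x].

Definition quot (x h : set nat) : set nat :=
  [set n |
    x `&` [set k | (enumeration h n <= k < enumeration h n.+1)%N] !=set0].

Definition quots (S : set Pomega) (h : set nat) : set Pomega :=
  [set quot x h | x in S].

Definition semifilter_trichotomy : Prop :=
  forall S : set Pomega, semifilter S -> exists2 h, infsets h &
    [\/ quots S h = [set a | finite_set (~` (a : set nat))],
        UltraFilter (quots S h : set_system nat) /\ quots S h `<=` infsets |
        quots S h = infsets].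

(* Any inhabited class of sets has a member of least cardinality. *)
Lemma exists_card_min T (P : set (set T)) : P !=set0 ->
  exists2 B, P B & forall C, P C -> B #<= C.
Proof.
move=> [B0 PB0].
(* A set [M] of functions choosing a point in each member of [P], with pairwise
   distinct values everywhere. *)
pose good (M : set (set T -> T)) := forall f, M f -> forall C, P C ->
  C (f C) /\ forall g, M g -> f C = g C -> f = g.
have [F FP Ftot|M [gM maxM]] := @Zorn_bigcup _ good.
  move=> f [M FM Mf] C PC; split; first by case: (FP _ FM _ Mf _ PC).
  move=> g [N FN Ng] e.
  case: (Ftot _ _ FM FN) => s.
    by case: (FP _ FN _ (s _ Mf) _ PC) => _; apply.
  by case: (FP _ FM _ Mf _ PC) => _; apply=> //; exact: s.
have injM C : P C -> [set f C | f in M] #= M.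
  move=> PC; apply: inj_card_eq => f g; rewrite !inE => Mf Mg e.
  by case: (gM _ Mf _ PC) => _; apply.
have [[B PB BM]|noB] := pselect (exists2 B, P B & B `<=` [set f B | f in M]).
  exists B => // C PC.
  apply: card_le_trans (subset_card_le BM) _.
  rewrite (card_le_eql (injM _ PB)) -(card_le_eql (injM _ PC)).
  by apply: subset_card_le => _ [f Mf <-]; case: (gM _ Mf _ PC).
have new C : P C -> exists2 t, C t & ~ [set f C | f in M] t.
  move=> PC; apply: contrapT => no; apply: noB; exists C => // t Ct.
  by apply: contrapT => nt; apply: no; exists t.
have [t0 _ _] := new _ PB0.
have /choice[g gP] C : exists t, P C -> C t /\ ~ [set f C | f in M] t.
  have [/new[t Ct nt]|nPC] := pselect (P C); first by exists t.
  by exists t0.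
exfalso; apply: (maxM (M `|` [set g])).
  split=> [f Mf|]; first by left.
  move=> /(_ g (or_intror erefl)) Mg.
  by case: (gP _ PB0) => _; apply; exists g.
move=> f [Mf|->] C PC.
  split; first by case: (gM _ Mf _ PC).
  move=> f' [Mf'|->] e; first by case: (gM _ Mf _ PC) => _; apply.
  by case: (gP _ PC) => _ []; exists f.
split; first by case: (gP _ PC).
move=> f' [Mf'|-> //] e.
by case: (gP _ PC) => _ []; exists f'.
Qed.

Lemma min_unbounded_bb : min_unbounded bb.
Proof.
apply: xgetPex.
have [|B uB minB] := @exists_card_min _ le_star_unbounded; last by exists B.
exists setT => -[g /(_ (fun n => (g n).+1) I)[N _ /(_ N)]] /=.
by rewrite leqnn ltnn => /(_ isT).
Qed.

Lemma is_enum_enumeration (a : set nat) :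
  infinite_set a -> is_enum a (enumeration a).
Proof.
move=> inf_a; apply: xgetPex.
have nextP m : exists k, (m <= k)%N && `[< a k >].
  apply: contrapT => no; apply: inf_a; apply: (@sub_finite_set _ _ `I_m).
    move=> k ak /=; rewrite ltnNge; apply/negP => mk; apply: no; exists k.
    by rewrite mk; apply/asboolP.
  exact: finite_II.
pose next m := ex_minn (nextP m).
pose f n := iter n (next \o S) (next 0).
have fa n : a (f n).
  by case: n => [|n] /=; rewrite /next; case: ex_minnP => k /andP[_ /asboolP].
have le_next m : (m <= next m)%N.
  by rewrite /next; case: ex_minnP => k /andP[].
have next_min m k : (m <= k)%N -> a k -> (next m <= k)%N.
  rewrite /next => mk ak; case: ex_minnP => l _; apply.
  by rewrite mk; apply/asboolP.
have fS n : (f n < f n.+1)%N by exact: le_next.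
exists f; split; first exact: (homo_ltn ltn_trans).
apply/seteqP; split => [_ [n _ <-] //|k ak].
have fge n : (n <= f n)%N.
  by elim: n => [//|n IH]; exact: leq_ltn_trans IH (fS n).
have exn : exists n, (k <= f n)%N by exists k.
case: (ex_minnP exn) => n kfn minn; exists n => //.
apply/eqP; rewrite eqn_leq kfn andbT.
case: n kfn minn => [|n] kfn minn.
  exact: next_min.
have fnk : (f n < k)%N by rewrite ltnNge; apply/negP => /minn; rewrite ltnn.
exact: next_min.
Qed.

(* Main.v *)
(* Write [en x] for the increasing enumeration of [x] and call a subset of [X]
   small if its cardinality is less than b.

   (1) => (4).  Compactness turns (1) into: for each [f], only a small set of
   [x] in [X] satisfies [en x <=* f].  The trichotomy implies that no family
   of size b is dominating; hence a b-scale [s] has a [g] dominated by no member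
   of [s], the sets [{n | s_i n <= g n}] generate a filter, and a quotient of
   this filter is an ultrafilter [V] with a base [w] of size b.  Suppose (4)
   fails at [b], and put [Q x = {n | en b n <= en x n}].  For each small
   [A], the semifilter generated by the [Q x] with [x] in [X \ A] is then not
   meager, so the trichotomy yields an interval partition [h] such that, modulo
   [h] and finite sets, each [w_j] contains such a [Q x].  Iterating along b
   gives increasing bounds [t_i], partitions [h_i] and points [xi i j] of [X] not
   bounded by [t_i], but with all earlier [xi] bounded by [t_i].  As no family of
   size b is dominating, there is an infinite set [e] so sparse that, for
   cofinally many [i], its trace on [h_i] misses a set of [V], hence misses some
   [Q (xi i j)] up to a finite set.  All these [xi i j] are bounded by one
   function read off [e], contradicting that the set of points so bounded is
   small.

   (4) => (3).  A cover of [(X u Fin) * Y] is handled at the points of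
   [Fin] first; by Hurewicz for [Y] this produces a partition [h] such that
   every [x] avoiding a suitable interval of [h] is covered.  If [en x] exceeds a
   subsequence of [h] on a set from a meager semifilter, Talagrand's
   characterization gives such an interval in almost every block of a fixed
   partition.  The small set of remaining [x] is handled by bounding fewer than b
   functions. *)

Require Import Defs.
From mathcomp Require Import all_boot all_order all_algebra.
From mathcomp Require Import all_classical all_reals all_analysis.
From mathcomp Require Import zify.
From mathcomp Require wochoice.
From Stdlib Require Wellfounded.Inverse_Image.

Set Implicit Arguments.
Unset Strict Implicit.
Unset Printing Implicit Defensive.

Local Open Scope classical_set_scope.
Local Open Scope card_scope.
Local Open Scope nat_scope.

(** * The cardinal b *)

Lemma finite_natP (a : set nat) :
  finite_set a <-> exists N, forall k, a k -> k < N.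
Proof.
split=> [/finite_seqP[s ->]|[N aN]]; last first.
  by apply: (@sub_finite_set _ _ `I_N) => //; exact: finite_II.
exists (\max_(i <- s) i).+1 => k ks.
by rewrite ltnS; apply: (@leq_bigmax_seq _ _ xpredT id).
Qed.

Lemma infinite_natP (a : set nat) :
  infinite_set a <-> forall N, exists2 k, N <= k & a k.
Proof.
split=> [ia N|ha /finite_natP[N aN]]; last first.
  by have [k Nk /aN] := ha N; rewrite ltnNge Nk.
apply: contrapT => no; apply: ia; apply/finite_natP; exists N => k ak.
by rewrite ltnNge; apply/negP => Nk; apply: no; exists k.
Qed.

Lemma infinite_setDfin (a b : set nat) :
  infinite_set a -> finite_set (a `\` b) -> infinite_set (a `&` b).
Proof.
by move=> ia fab fi; apply: ia; rewrite -(setUIDK a b) finite_setU.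
Qed.

Lemma le_starP (f g : nat -> nat) :
  le_star f g <-> exists N, forall n, N <= n -> f n <= g n.
Proof. by split=> [[N _ H]|[N H]]; exists N. Qed.

Lemma le_star_trans g f h : le_star f g -> le_star g h -> le_star f h.
Proof.
move=> /le_starP[N fg] /le_starP[M gh]; apply/le_starP; exists (maxn N M) => n.
by rewrite geq_max => /andP[/fg fgn /gh]; exact: leq_trans.
Qed.

Lemma countable_le_star (f : nat -> nat -> nat) :
  exists g, forall m, le_star (f m) g.
Proof.
exists (fun n => \max_(m < n.+1) f m n) => m; apply/le_starP; exists m => n mn.
by rewrite -ltnS in mn; exact: (leq_bigmax (Ordinal mn)).
Qed.

Lemma bb_min (C : set (nat -> nat)) : le_star_unbounded C -> bb #<= C.
Proof. by case: min_unbounded_bb => _; apply. Qed.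

(** The image of [A] under [f] is no larger than [A], so it cannot be unbounded. The hypothesis
    [~ (bb #<= A)] is the working form of having size less than b. *)
Lemma small_bounded U (A : set U) (f : U -> nat -> nat) : ~ (bb #<= A) ->
  exists g, forall x, A x -> le_star (f x) g.
Proof.
move=> sA; apply: contrapT => no; apply: sA.
apply: (card_le_trans _ (card_image_le f A)); apply: bb_min => -[g gP].
by apply: no; exists g => x Ax; apply: gP; exists x.
Qed.

Lemma not_bb_le_countable U (A : set U) : countable A -> ~ (bb #<= A).
Proof.
move=> fA bA; have [uB _] := min_unbounded_bb.
have fB : countable bb by exact: card_le_trans bA fA.
have /pcard_injP[f finj] := fB; refine (uB _).
pose e k := xget (fun=> 0) [set g | bb g /\ f g = k].
have [g gP] := countable_le_star e; exists g => h bh.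
have := gP (f h); rewrite /e; case: xgetP => [h' _ [bh' /finj]|/(_ h)[]//].
by rewrite !inE => ->.
Qed.

(** Both sets are copied into the sum type, where [exists_card_min] picks the smaller of the two
    copies. *)
Lemma card_le_total T U (A : set T) (B : set U) : A #<= B \/ B #<= A.
Proof.
pose A' := (inl : T -> T + U) @` A; pose B' := (inr : U -> T + U) @` B.
have eA : A' #= A by apply: inj_card_eq => x y _ _ [].
have eB : B' #= B by apply: inj_card_eq => x y _ _ [].
have [|C [->|->] minC] := @exists_card_min _ [set C | C = A' \/ C = B'].
- by exists A'; left.
- by left; rewrite -(card_le_eql eA) -(card_le_eqr eB); apply: minC; right.
- by right; rewrite -(card_le_eql eB) -(card_le_eqr eA); apply: minC; left.
Qed.

Lemma card_ltP T U (A : set T) (B : set U) : card_lt A B <-> ~ (B #<= A).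
Proof.
by split=> [[]//|nBA]; split=> //; case: (card_le_total A B).
Qed.

(* [T] plays the role of the ordinal b: proper initial segments have fewer than
   b elements, which is only used through the boundedness of the families they
   index; [u] enumerates an unbounded family. *)
Definition bounding_index T (lt : T -> T -> Prop) (u : T -> nat -> nat) :=
  [/\ well_founded lt,
      (forall x y z, lt x y -> lt y z -> lt x z),
      (forall x y, lt x y \/ (x = y \/ lt y x)),
      (forall x (f : T -> nat -> nat), exists g, forall y, lt y x ->
        le_star (f y) g) &
      ~ (exists g, forall x, le_star (u x) g) /\ [set: T] #<= bb].

Lemma exists_bounding_index : exists T lt u, @bounding_index T lt u.
Proof.
have [R woR] := wochoice.well_ordering_principle (nat -> nat : eqType).
pose lt f g := R f g /\ f <> g.
have inA (A : set (nat -> nat)) x : x \in [pred x | `[< A x >]] <-> A x.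
  by rewrite unfold_in; split=> /asboolP.
have minR (A : set (nat -> nat)) : A !=set0 ->
    exists2 z, A z & forall x, A x -> R z x.
  move=> [x Ax]; have [|z [[/inA Az lbz] _]] := woR [pred x | `[< A x >]].
    by exists x; apply/inA.
  by exists z => // y /inA; exact: lbz.
have uminR (A : set (nat -> nat)) z z' : A z -> A z' ->
    (forall x, A x -> R z x) -> (forall x, A x -> R z' x) -> z = z'.
  move=> Az Az' lz lz'.
  have [|y [_ yu]] := woR [pred x | `[< A x >]]; first by exists z; apply/inA.
  by rewrite -(yu z) ?(yu z') //; split=> [|x /inA]; [exact/inA|exact: lz'
    |exact/inA|exact: lz].
have Rtot x y : R x y \/ R y x.
  have [|z [->|->] lz] := minR [set z | z = x \/ z = y].
  - by exists x; left.
  - by left; apply: lz; right.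
  - by right; apply: lz; left.
have Rxx x : R x x by case: (Rtot x x).
have Ranti x y : R x y -> R y x -> x = y.
  move=> xy yx; apply: (uminR [set z | z = x \/ z = y]);
    [by left|by right|..]; by move=> z [->|->].
have Rtr x y z : R x y -> R y z -> R x z.
  move=> xy yz; have [|t] := minR [set t | [\/ t = x, t = y | t = z]].
    by exists x; constructor.
  case=> -> lt'.
  - by apply: lt'; constructor 3.
  - have -> : x = y by apply: Ranti => //; apply: lt'; constructor.
    exact: yz.
  - have e : y = z by apply: Ranti => //; apply: lt'; constructor.
    by rewrite -e.
have lttr x y z : lt x y -> lt y z -> lt x z.
  move=> [xy nxy] [yz nyz]; split; first exact: Rtr yz.
  by move=> e; apply: nxy; apply: Ranti => //; rewrite e.
have lttot x y : lt x y \/ (x = y \/ lt y x).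
  have [->|nxy] := pselect (x = y); first by right; left.
  case: (Rtot x y) => H; first by left.
  by right; right; split=> // /esym.
have ltwf : well_founded lt.
  move=> x; apply: contrapT => nx.
  have [|z nz lz] := minR [set x | ~ Acc lt x]; first by exists x.
  apply: nz; constructor=> y [yz nyz]; apply: contrapT => /lz zy.
  by apply: nyz; exact: Ranti.
(* An initial segment of [bb] that is minimal among those of size at least
   that of [bb]. *)
have [I [Ib bI segI]] : exists I : set (nat -> nat), [/\ I `<=` bb, bb #<= I &
    forall x, I x -> ~ (bb #<= I `&` [set y | lt y x])].
  have [[z Pz]|no] := pselect (exists z, bb #<= bb `&` [set y | lt y z]).
    have [|x Px lx] := minR [set z | bb #<= bb `&` [set y | lt y z]].
      by exists z.
    exists (bb `&` [set y | lt y x]); split=> [y []//|//|y [by_ yx] Py].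
    have /lx xy : bb #<= bb `&` [set z | lt z y].
      by apply: card_le_trans Py _; apply: subset_card_le => t [[bt _] ty].
    by case: yx => yx; apply; exact: Ranti.
  exists bb; split=> [//||x bx Px]; first exact: card_lexx.
  by apply: no; exists x.
have /card_leP[phi] := bI.
(* [u] inverts the injection [phi], with value zero off its range, so all of [bb] occurs among the
   [u x]. *)
pose u (x : I) := xget (fun=> 0) [set g | exists b : bb, set_val b = g /\ phi b = x].
exists I, (fun x y => lt (set_val x) (set_val y)), u; split.
- by apply: (@Inverse_Image.wf_inverse_image _ _ lt set_val).
- by move=> x y z; exact: lttr.
- move=> x y; case: (lttot (set_val x) (set_val y)) => [|[/val_inj|]];
    [by left|by right; left|by right; right].
- move=> x f; have Ix : I (set_val x) by exact: set_valP.
  pose f' (g : nat -> nat) :=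
    xget (fun=> 0) [set h | exists y : I, set_val y = g /\ f y = h].
  have [g gP] := small_bounded f' (segI _ Ix).
  exists g => y yx; have := gP (set_val y); rewrite /f'.
  case: xgetP => [h _ [y' [/val_inj-> <-]]|/(_ (f y)) no _]; last first.
    by exfalso; apply: no; exists y.
  by apply; split=> //; exact: set_valP.
split; last first.
  by rewrite (card_le_eql (card_setT I)); exact: subset_card_le.
move=> [g gP]; have [uB _] := min_unbounded_bb; refine (uB _); exists g => b bb_b.
pose b' : bb := SigSub (mem_set bb_b).
have := gP (phi b'); rewrite /u; case: xgetP => [h _ [b'' [<-]]|]; last first.
  by move=> /(_ b) []; exists b'.
by move=> /inj e; rewrite -[b]/(set_val b') -e // inE.
Qed.

Lemma wf_irreflexive T (lt : T -> T -> Prop) x : well_founded lt -> ~ lt x x.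
Proof. by move=> wf; elim: (wf x) => y _ IH yy; exact: (IH y yy yy). Qed.

Lemma runmax (f : nat -> nat) :
  exists2 g : nat -> nat, {homo g : m n / m <= n} & forall n, f n <= g n.
Proof.
exists (fun n => \max_(i < n.+1) f i) => [m n mn|n].
  apply/bigmax_leqP => i _; have lt_i : i < n.+1 by rewrite (leq_trans (ltn_ord i)).
  exact: (leq_bigmax (Ordinal lt_i)).
exact: (leq_bigmax ord_max).
Qed.

Section bounding_index.
Context (T : Type) (lt : T -> T -> Prop) (u : T -> nat -> nat).
Context (idx : bounding_index lt u).

Lemma index_unbounded : ~ (exists g, forall x, le_star (u x) g).
Proof. by case: idx => _ _ _ _ []. Qed.

Lemma index_directed x y : exists2 z, lt x z & lt y z.
Proof.
have [_ tr tot seg [unb _]] := idx.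
(* Otherwise a bound for the segment below [z], raised to majorize [u z] as well, would bound all of
   [u]. *)
have nomax z : exists t, lt z t.
  apply: contrapT => no; apply: unb; have [g gP] := seg z u.
  exists (fun n => maxn (g n) (u z n)) => t.
  case: (tot t z) => [/gP ltg|[->|zt]]; last by exfalso; apply: no; exists t.
    by apply: le_star_trans ltg _; apply/le_starP; exists 0 => n _; exact: leq_maxl.
  by apply/le_starP; exists 0 => n _; exact: leq_maxr.
case: (tot x y) => [xy|[->|yx]].
- by have [z yz] := nomax y; exists z => //; exact: tr xy yz.
- by have [z yz] := nomax y; exists z.
- by have [z xz] := nomax x; exists z => //; exact: tr yx xz.
Qed.

(* [Phi] may depend on the function [t y] already constructed. *)
Lemma tower_rec (Phi : T -> (nat -> nat) -> T -> nat -> nat) (b : nat -> nat) :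
  exists t : T -> nat -> nat, forall x,
    [/\ {homo t x : m n / m <= n}, le_star b (t x) &
      forall y, lt y x -> le_star (t y) (t x) /\
        forall z, lt z x -> le_star (Phi y (t y) z) (t x)].
Proof.
have [wf _ _ seg _] := idx.
have step (xp : T * (T -> nat -> nat)) : exists g : nat -> nat,
    [/\ {homo g : m n / m <= n}, le_star b g & forall y, lt y xp.1 ->
      le_star (xp.2 y) g /\
      forall z, lt z xp.1 -> le_star (Phi y (xp.2 y) z) g].
  case: xp => x p /=; have [g0 g0P] := seg x p.
  (* The family indexed by pairs below [x] is bounded in two rounds: [g1 y] for fixed [y], then [g2]
     above all the [g1 y]. *)
  have /choice[g1 g1P] y : exists g, forall z, lt z x -> le_star (Phi y (p y) z) g.
    exact: seg.
  have [g2 g2P] := seg x g1.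
  have [g gmono gP] := runmax (fun n => b n + (g0 n + g2 n)).
  have le_g f : (forall n, f n <= b n + (g0 n + g2 n)) -> le_star f g.
    by move=> fle; apply/le_starP; exists 0 => n _; exact: leq_trans (gP n).
  exists g; split=> // [|y yx]; first by apply: le_g => n; exact: leq_addr.
  split=> [|z zx].
    by apply: le_star_trans (g0P _ yx) _; apply: le_g => n; lia.
  apply: le_star_trans (g1P _ _ zx) _; apply: le_star_trans (g2P _ yx) _.
  by apply: le_g => n; lia.
have [G GP] := choice step.
pose F x (rec : forall y, lt y x -> nat -> nat) : nat -> nat :=
  G (x, fun y => if pselect (lt y x) is left h then rec y h else fun=> 0).
have Fext x (r r' : forall y, lt y x -> nat -> nat) :
    (forall y h, r y h = r' y h) -> F x r = F x r'.
  move=> e; congr (G (x, _)); apply/funext => y.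
  by case: pselect => // h; rewrite e.
pose t := Fix wf _ F; exists t => x.
have tE : t x = G (x, fun y => if pselect (lt y x) is left h then t y else fun=> 0).
  by rewrite /t Fix_eq.
rewrite tE; set p := fun y => _; have [/= mono bG GP'] := GP (x, p).
by split=> // y yx; have := GP' y yx; rewrite /p; case: pselect.
Qed.

(** Along a tower that rises above every [u x], a common bound at cofinally many indices would bound
    [u]; so the image of [C] under the tower is unbounded. *)
Lemma bb_le_cofinal (C : set T) : (forall x, exists2 c, C c & lt x c) -> bb #<= C.
Proof.
move=> cofC; have [t tP] := tower_rec (fun y _ _ => u y) (fun=> 0).
apply: (card_le_trans _ (card_image_le t C)); apply: bb_min => -[g gP].
apply: index_unbounded; exists g => x; have [c Cc xc] := cofC x.
apply: le_star_trans (gP (t c) _); last by exists c.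
by have [_ _ /(_ x xc)[_ /(_ x xc)]] := tP c.
Qed.

(** The regularity of b; linearity turns the failure of cofinality into a strict upper bound. *)
Lemma small_lt_bounded (C : set T) : ~ (bb #<= C) -> exists x, forall c, C c -> lt c x.
Proof.
move=> sC; apply: contrapT => no; apply: sC; apply: bb_le_cofinal => x.
apply: contrapT => noc; apply: no; have [y xy _] := index_directed x x.
have [_ tr tot _ _] := idx.
exists y => c Cc; case: (tot c x) => [cx|[->//|xc]]; first exact: tr xy.
by exfalso; apply: noc; exists c.
Qed.

End bounding_index.

(** An injection of the index type into the union covers the indices by countably many small, hence
    bounded, pieces; an index above all the bounds lies in no piece. *)
Lemma not_bb_le_bigcup U (B : nat -> set U) :
  (forall m, ~ (bb #<= B m)) -> ~ (bb #<= \bigcup_m B m).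
Proof.
move=> sB bU; have [T [lt [u idx]]] := exists_bounding_index.
have [wf tr _ _ [_ Tb]] := idx.
have /card_leP[phi0] := card_le_trans Tb bU.
pose phi (x : T) : U := set_val (phi0 (to_setT x)).
have inj_phi x y : phi x = phi y -> x = y.
  by move=> /val_inj /inj; rewrite !inE => /(_ I I)[].
pose C m := [set x | B m (phi x)].
have /choice[y yP] m : exists x, forall c, C m c -> lt c x.
  apply: (small_lt_bounded idx) => bC; apply: (sB m); apply: card_le_trans bC _.
  rewrite /C -[X in X #<= _]/(phi @^-1` B m).
  by apply: card_ge_preimage => a c _ _; exact: inj_phi.
have [z zP] : exists z, forall c, range y c -> lt c z.
  apply: (small_lt_bounded idx); apply: not_bb_le_countable.
  exact: card_image_le.
have [m _ /yP zy] : (\bigcup_m B m) (phi z) by exact: set_valP.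
by apply: (@wf_irreflexive _ lt z wf); apply: tr zy _; apply: zP; exists m.
Qed.

(** * Interval partitions and the trichotomy *)

Lemma incr_leq (e : nat -> nat) : {homo e : m n / m < n} -> forall m n, (e m <= e n) = (m <= n).
Proof. by move=> he m n; apply: (leq_mono (f := e)). Qed.

Lemma incr_ltn (e : nat -> nat) : {homo e : m n / m < n} -> forall m n, (e m < e n) = (m < n).
Proof. by move=> he m n; rewrite !ltnNge incr_leq. Qed.

Lemma incr_ge (e : nat -> nat) : {homo e : m n / m < n} -> forall n, n <= e n.
Proof. by move=> he; elim=> // n IH; apply: leq_ltn_trans IH (he _ _ _). Qed.

Lemma range_incr_infinite (e : nat -> nat) : {homo e : m n / m < n} -> infinite_set (range e).
Proof.
move=> he; apply/infinite_natP => N; exists (e N); first exact: incr_ge.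
by exists N.
Qed.

Lemma ex_block (e : nat -> nat) k : {homo e : m n / m < n} -> e 0 <= k ->
  exists n, e n <= k < e n.+1.
Proof.
move=> he e0k; have ex : exists n, k < e n by exists k.+1; exact: incr_ge.
case: (ex_minnP ex) => -[|n]; first by rewrite ltnNge e0k.
by move=> kn minn; exists n; rewrite kn andbT leqNgt; apply/negP => /minn; rewrite ltnn.
Qed.

(** This is [quot] with the partition given by an increasing function instead of the infinite set
    that it enumerates. *)
Definition block (e : nat -> nat) (x : set nat) : set nat :=
  [set n | exists2 k, x k & e n <= k < e n.+1].

Lemma quotE x h : quot x h = block (enumeration h) x.
Proof. by apply/seteqP; split=> n /= [k]; [move=> []|]; exists k. Qed.

Lemma block_infinite e x : {homo e : m n / m < n} -> infinite_set x -> infinite_set (block e x).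
Proof.
move=> he /infinite_natP ix; apply/infinite_natP => N.
have [k ek xk] := ix (e N); have [|n nk] := @ex_block e k he.
  by apply: leq_trans ek; rewrite incr_leq.
exists n; last by exists k.
have /andP[_ kn] := nk; rewrite -ltnS -(incr_ltn he); exact: leq_ltn_trans kn.
Qed.

Lemma block_finiteD e x y : {homo e : m n / m < n} -> finite_set (x `\` y) ->
  finite_set (block e x `\` block e y).
Proof.
move=> he /finite_natP[N xyN]; apply/finite_natP; exists N => n [[k xk nk] ny].
rewrite (leq_ltn_trans (incr_ge he n)) // (leq_ltn_trans _ (xyN k _)) //.
  by case/andP: nk.
by split=> // yk; apply: ny; exists k.
Qed.

Lemma trichotomy_block (S : set Pomega) : semifilter_trichotomy -> semifilter S ->
  exists2 e : nat -> nat, {homo e : m n / m < n} &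
  [\/ forall a, S a -> finite_set (~` block e a),
      UltraFilter (block e @` S : set_system nat) /\
        forall a, S a -> infinite_set (block e a) |
      forall d : set nat, infinite_set d -> exists2 a, S a & block e a = d].
Proof.
move=> tri sS; have [h /is_enum_enumeration[he _] cases] := tri S sS.
have qE : quots S h = block (enumeration h) @` S.
  by apply/seteqP; split=> _ [x Sx <-]; exists x => //; rewrite quotE.
exists (enumeration h) => //; move: cases; rewrite qE.
case=> [qS|[ultra qS]|qS]; [constructor 1|constructor 2|constructor 3].
- by move=> a Sa; have : (block (enumeration h) @` S) (block (enumeration h) a);
    [exists a|rewrite qS].
- by split=> // a Sa; apply: qS; exists a.
- move=> d id; have : (block (enumeration h) @` S) d by rewrite qS.
  by case=> a; exists a.
Qed.

(** Each rung lies beyond the value of [f] at the previous rung, so the intervals between rungs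
    outgrow [f]. *)
Definition ladder (f : nat -> nat) n := iter n (fun k => (k + f k).+1) 0.

Arguments ladder : simpl never.

Lemma ladderS f n : ladder f n.+1 = (ladder f n + f (ladder f n)).+1.
Proof. by []. Qed.

Lemma ladder_incr f : {homo ladder f : m n / m < n}.
Proof. by apply: homo_ltn => [y x z|n]; [exact: ltn_trans|rewrite ladderS ltnS leq_addr]. Qed.

Section non_dominating.
Context (T : Type) (lt : T -> T -> Prop) (u : T -> nat -> nat).
Context (idx : bounding_index lt u).

(* [gap x false] and [gap x true] consist of every fourth interval of the
   ladder of [t x], with a whole interval separating them. *)
Let gap (t : T -> nat -> nat) x (i : bool) : set nat :=
  [set k | exists n, ladder (t x) (4 * n + 2 * i) <= k < ladder (t x) (4 * n + 2 * i).+1].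

(* A dominating family of size b would yield a semifilter none of whose
   quotients is as the trichotomy demands. *)
Lemma non_dominating (D : T -> nat -> nat) : semifilter_trichotomy ->
  exists p, forall x, ~ le_star p (D x).
Proof.
move=> tri; apply: contrapT => nD.
have {nD} domD p : exists x, le_star p (D x).
  by apply: contrapT => no; apply: nD; exists p => x pD; apply: no; exists x.
have [_ tr tot seg _] := idx.
have [t tP] := tower_rec idx (fun y _ _ => D y) (fun=> 0).
have {domD} domt p : exists x, forall y, lt x y -> le_star p (t y).
  have [x px] := domD p; exists x => y xy; apply: le_star_trans px _.
  by have [_ _ /(_ x xy)[_ /(_ x xy)]] := tP y.
pose r x := ladder (t x).
have rI x : {homo r x : m n / m < n} by exact: ladder_incr.
(* Among any four consecutive ladder indices one is congruent to [2 * i] modulo 4; the rung at the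
   first such index from [K] on is the witness. *)
have gap_meets x (i : bool) K : exists2 k, gap t x i k & K <= k < r x K.+4.
  pose q0 := 4 * (K %/ 4) + 2 * i.
  have [Kq0|q0K] := leqP K q0.
    exists (r x q0); first by exists (K %/ 4); rewrite leqnn /=; apply: ladder_incr.
    rewrite (leq_trans Kq0 (incr_ge (rI x) q0)) /=. apply: rI; lia.
  pose q1 := 4 * (K %/ 4).+1 + 2 * i.
  exists (r x q1); first by exists (K %/ 4).+1; rewrite leqnn /=; apply: ladder_incr.
  rewrite (leq_trans _ (incr_ge (rI x) q1)) /=; last by lia.
  by apply: rI; lia.
have gap_inf x i : infinite_set (gap t x i).
  apply/infinite_natP => K; have [k gk /andP[Kk _]] := gap_meets x i K.
  by exists k.
pose S : set Pomega := [set a | exists x i, finite_set (gap t x i `\` (a : set nat))].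
have sS : semifilter S.
  split.
  - have [x _] : exists x : T, True.
      apply: contrapT => no; apply: (index_unbounded idx).
      by exists (fun=> 0) => x; exfalso; apply: no; exists x.
    by exists (gap t x true), x, true; rewrite setDv.
  - move=> a [x [i fa]]; have := infinite_setDfin (@gap_inf x i) fa.
    by apply: sub_infinite_set => k [].
  - move=> a b [x [i fa]] _ fab; exists x, i.
    apply: (@sub_finite_set _ _ ((gap t x i `\` a) `|` (a `\` b))); last first.
      by rewrite finite_setU.
    move=> k [gk nbk]; have [ak|nak] := pselect ((a : set nat) k); by [right|left].
have Sgap x i : S (gap t x i) by exists x, i; rewrite setDv.
have [e he cases] := trichotomy_block tri sS.
have [x0 x0P] := domt (fun k => e k.+2).
(* Where [t x] exceeds [e] shifted by two, a ladder interval is too long to lie between two points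
   of one block of [e]. *)
have far x k k' q N n : (forall k, N <= k -> e k.+2 <= t x k) -> N <= n ->
    e n <= k < e n.+1 -> e n <= k' < e n.+1 -> k < r x q -> r x q.+1 <= k' -> False.
  move=> Nt Nn /andP[nk _] /andP[_ k'n] kq qk'.
  have nq : n < r x q by rewrite (leq_ltn_trans _ kq) // (leq_trans (incr_ge he n)).
  have := Nt _ (leq_trans Nn (ltnW nq)); rewrite leqNgt => /negP; apply.
  have : e n.+1 <= e (r x q).+2 by rewrite incr_leq //; lia.
  apply: leq_trans; apply: leq_trans k'n; rewrite ltnS; apply: leq_trans qk'.
  by rewrite /r ladderS; lia.
(* For large [x] the two gaps of [x] share only finitely many blocks, which rules out the cofinite
   and the ultrafilter case. *)
have two : (forall a b, S a -> S b -> infinite_set (block e a `&` block e b)) -> False.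
  move=> /(_ _ _ (Sgap _ _) (Sgap _ _)) inf.
  have [x x0x _] := index_directed idx x0 x0.
  have /le_starP[N NP] := x0P _ x0x.
  have /infinite_natP/(_ N)[n Nn [[k [m km] kn] [k' [m' km'] k'n]]] := inf x false x true.
  have [mm'|m'm] := leqP m m'.
    apply: (far x k k' (4 * m).+1 N n NP Nn kn k'n).
      by case/andP: km => _; rewrite muln0 addn0.
    case/andP: km' => + _; apply: leq_trans; rewrite incr_leq //; lia.
  apply: (far x k' k (4 * m').+3 N n NP Nn k'n kn).
    by case/andP: km' => _; rewrite muln1 addn2.
  case/andP: km => + _; apply: leq_trans; rewrite incr_leq //; lia.
case: cases => [cof|[ultra inf]|full].
- apply: two => a b /cof fa /cof fb; rewrite -[_ `&` _]setCK setCI.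
  have : finite_set (~` block e a `|` ~` block e b) by rewrite finite_setU.
  move=> /finite_natP[N Na]; apply/infinite_natP => M; exists (maxn N M); first exact: leq_maxr.
  by move=> /Na; rewrite ltnNge leq_maxl.
- apply: two => a b Sa Sb.
  have [c Sc <-] : (block e @` S) (block e a `&` block e b).
    by apply: filterI; [exists a|exists b].
  exact: inf.
have [x1 x01 _] := index_directed idx x0 x0.
have [g gP] := seg x1 (fun x k => r x k.+4).
(* The range of [j] is no quotient of a member of [S]: it outruns [g], which excludes the gaps of
   [x] below [x1], and it has no two consecutive elements, which excludes the gaps of [x] above
   [x0]. *)
pose j n := iter n (fun m => (m + g (e m.+1)).+2) 0.
have jS n : j n.+1 = (j n + g (e (j n).+1)).+2 by [].
have jI : {homo j : m n / m < n}.
  by apply: homo_ltn => [y x z|n]; [exact: ltn_trans|rewrite jS; lia].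
have [a [x [i /finite_natP[M aM]]] ad] := full _ (range_incr_infinite jI).
have {}aM k : gap t x i k -> M <= k -> a k.
  by move=> gk Mk; apply: contrapT => nak; have := aM k (conj gk nak); rewrite ltnNge Mk.
have range_block l : block e a l -> exists m, l = j m.
  by rewrite ad => -[m _ <-]; exists m.
have [/gP /le_starP[N0 N0P]|x0x] : lt x x1 \/ lt x0 x.
- by case: (tot x x0) => [xx0|[->|]]; [left; exact: tr xx0 x01|left|right].
- pose n := maxn M N0; pose K := e (j n).+1.
  have nK : n <= K.
    by apply: leq_trans (incr_ge he _); apply: leqW; exact: incr_ge.
  have [k gk /andP[Kk kK]] := gap_meets x i K.
  have kg : k < g K by apply: leq_trans kK _; apply: N0P; apply: leq_trans nK; exact: leq_maxr.
  have ak : a k by apply: aM => //; apply: leq_trans Kk; apply: leq_trans nK; exact: leq_maxl.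
  have [|l lk] := @ex_block e k he.
    by apply: leq_trans Kk; rewrite incr_leq.
  have [m lm] : exists m, l = j m by apply: range_block; exists k.
  have /andP[lk1 lk2] := lk.
  have : (j n).+1 < l.+1 by rewrite -(incr_ltn he); exact: leq_ltn_trans Kk lk2.
  have : l < j n.+1.
    rewrite -(incr_ltn he); apply: leq_ltn_trans lk1 _; apply: leq_trans kg _.
    apply: leq_trans (incr_ge he _); rewrite jS -/K; lia.
  by rewrite lm (incr_ltn jI) => mn; rewrite ltnS (incr_ltn jI); lia.
- have /le_starP[N0 N0P] := x0P _ x0x.
  pose q := 4 * maxn M N0 + 2 * i; pose K := r x q.
  have qK : q <= K by exact: incr_ge.
  have gapK k : K <= k < e K.+2 -> gap t x i k.
    move=> /andP[Kk kK]; exists (maxn M N0); rewrite Kk ladderS ltnS ltnW //=.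
    apply: (leq_trans kK); apply: leq_trans (leq_addl _ _); apply: N0P; lia.
  have bK l : K <= l <= K.+1 -> block e a l.
    move=> /andP[Kl lK]; exists (e l); last by rewrite leqnn he.
    have Kel : K <= e l by exact: leq_trans (incr_ge he _).
    by apply: aM; [apply: gapK; rewrite Kel incr_ltn|lia].
  have [m Km] := range_block K (bK K ltac:(by rewrite leqnn leqnSn)).
  have [m' Km'] := range_block K.+1 (bK K.+1 ltac:(by rewrite leqnSn leqnn)).
  have mm' : m < m' by rewrite -(incr_ltn jI) -Km -Km'.
  have : j m.+1 <= j m' by rewrite incr_leq.
  by rewrite -Km' jS -Km; lia.
Qed.

End non_dominating.

(** * Ultrafilters obtained from the trichotomy *)

Lemma block_uniq (e : nat -> nat) k m n : {homo e : m n / m < n} ->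
  e m <= k < e m.+1 -> e n <= k < e n.+1 -> m = n.
Proof.
move=> he /andP[mk km] /andP[nk kn].
have : m < n.+1 by rewrite -(incr_ltn he); exact: leq_ltn_trans kn.
have : n < m.+1 by rewrite -(incr_ltn he); exact: leq_ltn_trans km.
lia.
Qed.

Lemma block_finite e x : {homo e : m n / m < n} -> finite_set x -> finite_set (block e x).
Proof.
move=> he fx; have -> : block e x = block e x `\` block e set0.
  by apply/seteqP; split=> [n bn|n []//]; split=> // -[].
by apply: block_finiteD; rewrite ?setD0.
Qed.

Definition unblock (e : nat -> nat) (d : set nat) : set nat :=
  [set k | exists2 n, d n & e n <= k < e n.+1].

Lemma unblockK e d : {homo e : m n / m < n} -> block e (unblock e d) = d.
Proof.
move=> he; apply/seteqP; split=> [n [k [m dm mk] nk]|n dn].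
  by rewrite (block_uniq he nk mk).
by exists (e n); rewrite ?leqnn ?he //; exists n; rewrite ?leqnn ?he.
Qed.

Lemma block_disjoint e a b : {homo e : m n / m < n} ->
  block e a `&` block e b = set0 -> finite_set (a `&` b).
Proof.
move=> he ab0; apply/finite_natP; exists (e 0) => k [ak bk].
rewrite ltnNge; apply/negP => /(ex_block he)[n nk].
have : (block e a `&` block e b) n by split; exists k.
by rewrite ab0.
Qed.

Lemma evens_infinite : infinite_set [set n | ~~ odd n].
Proof. by apply/infinite_natP => N; exists N.*2; rewrite /= ?odd_double // -addnn leq_addr. Qed.

Lemma odds_infinite : infinite_set [set n | odd n].
Proof.
by apply/infinite_natP => N; exists N.*2.+1; rewrite /= ?odd_double // -addnn; lia.
Qed.

(** Modulo finite sets the [v x] decrease, so they generate a filter; once the other cases of the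
    trichotomy are excluded, the quotients of the [v x] are the base. *)
Lemma small_base_ultrafilter T (lt : T -> T -> Prop) u :
  bounding_index lt u -> semifilter_trichotomy ->
  exists (V : set_system nat) (w : T -> set nat),
    [/\ UltraFilter V, forall a, V a -> infinite_set a, forall x, V (w x) &
      forall a, V a -> exists x, finite_set (w x `\` a)].
Proof.
move=> idx tri; have [t tP] := tower_rec idx (fun y _ _ => u y) (fun=> 0).
have [g gP] := non_dominating idx t tri.
pose v x : set nat := [set n | t x n <= g n].
have vI x : infinite_set (v x).
  apply/infinite_natP => N; apply: contrapT => no; apply: (gP x).
  apply/le_starP; exists N => n Nn; rewrite leqNgt; apply/negP => /ltnW tg.
  by apply: no; exists n.
have vD x y : lt y x -> finite_set (v x `\` v y).
  move=> yx; have [_ _ /(_ y yx)[/le_starP[N tN] _]] := tP x.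
  apply/finite_natP; exists N => k [xk nk]; rewrite ltnNge; apply/negP => /tN.
  by move=> /leq_trans /(_ xk).
pose F : set Pomega := [set a | exists x, finite_set (v x `\` (a : set nat))].
have Fv x : F (v x) by exists x; rewrite setDv.
have sF : semifilter F.
  split.
  - have [x _] : exists x : T, True.
      apply: contrapT => no; apply: (index_unbounded idx).
      by exists (fun=> 0) => x; exfalso; apply: no; exists x.
    by exists (v x).
  - move=> a [x fa]; have := infinite_setDfin (@vI x) fa.
    by apply: sub_infinite_set => k [].
  - move=> a b [x fa] _ fab; exists x.
    apply: (@sub_finite_set _ _ ((v x `\` a) `|` (a `\` b))); last first.
      by rewrite finite_setU.
    move=> k [gk nbk]; have [ak|nak] := pselect ((a : set nat) k); by [right|left].
have [e he [cof|[ultra inf]|full]] := trichotomy_block tri sF.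
- exfalso; apply: (index_unbounded idx).
  have [h hmono hg] := runmax g.
  (* If [v y] meets almost every block, a point of [v y] in block [n] bounds [t y n] by
     monotonicity. *)
  exists (fun n => h (e n.+1)) => x; have [y xy _] := index_directed idx x x.
  have [tm _ /(_ x xy)[_ /(_ x xy) uty]] := tP y.
  apply: le_star_trans uty _.
  have /finite_natP[N NP] := cof _ (Fv y).
  apply/le_starP; exists N => n Nn.
  have [m /= vm /andP[nm mn]] : block e (v y) n.
    by apply: contrapT => /NP; rewrite ltnNge Nn.
  apply: leq_trans (tm _ _ (leq_trans (incr_ge he n) nm)) _.
  by apply: (leq_trans vm); apply: leq_trans (hg m) _; exact/hmono/ltnW.
- exists (block e @` F), (fun x => block e (v x)); split=> //.
  + by move=> _ [a /inf ia <-].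
  + by move=> x; exists (v x).
  + by move=> _ [a [x fa] <-]; exists x; exact: block_finiteD.
(* Sets with disjoint quotients are almost disjoint, which two members of a filter of infinite sets
   cannot be. *)
- exfalso; have [a [x fa] ea] := full _ evens_infinite.
  have [b [y fb] eb] := full _ odds_infinite.
  have [z xz yz] := index_directed idx x y.
  have fab : finite_set (a `&` b).
    apply: (block_disjoint he); rewrite ea eb.
    by apply/seteqP; split=> // n [/= /negP].
  apply: (@vI z); have : finite_set ((v z `\` v x) `|` (v z `\` v y) `|`
      (v x `\` a) `|` (v y `\` b) `|` (a `&` b)).
    by rewrite !finite_setU; do !split=> //; exact: vD.
  apply: sub_finite_set => k zk.
  have [xk|?] := pselect (v x k); last by do 4 left.
  have [yk|?] := pselect (v y k); last by do 3 left; right.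
  have [ak|?] := pselect ((a : set nat) k); last by do 2 left; right.
  have [bk|?] := pselect ((b : set nat) k); last by left; right.
  by right.
Qed.

(* The trichotomy is applied to [V] together with the sets that meet every
   member of [Q] infinitely often: it excludes all but the ultrafilter case. *)
Lemma coherent_with_ultrafilter (V : set_system nat) (Q : set (set nat)) :
  semifilter_trichotomy -> UltraFilter V -> (forall a, V a -> infinite_set a) ->
  (forall q, Q q -> infinite_set q) ->
  (forall e : nat -> nat, {homo e : m n / m < n} ->
    exists2 q, Q q & infinite_set (~` block e q)) ->
  exists2 e : nat -> nat, {homo e : m n / m < n} &
    forall v, V v -> exists2 q, Q q & finite_set (block e q `\` block e v).
Proof.
move=> tri uV Vinf Qinf Qbig.
pose S : set Pomega := [set a | (forall q, Q q -> infinite_set ((a : set nat) `&` q)) \/ V a].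
have sS : semifilter S.
  split.
  - by exists (setT : set nat); right; exact: filterT.
  - move=> a [aQ|/Vinf//]; have [|q Qq _] := Qbig id; first by [].
    by apply: sub_infinite_set (aQ q Qq) => k [].
  - move=> a b Sa _ fab; case: Sa => [aQ|Va]; [left => q Qq|right].
      have : infinite_set ((a `&` q) `&` b).
        apply: infinite_setDfin; first exact: aQ.
        by apply: sub_finite_set fab => k [[]].
      by apply: sub_infinite_set => k [[_ qk] bk].
    have [//|Vb] := in_ultra_setVsetC b uV.
    by exfalso; apply: (Vinf _ (filterI Va Vb)).
have [e he cases] := trichotomy_block tri sS; exists e => // v Vv.
case: cases => [cof|[ultra _]|full].
(* Either this union of odd-numbered intervals or its complement is in [V], and each misses
   infinitely many blocks. *)
- pose a : set nat := unblock e [set n | odd n].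
  have bad b : V b -> (exists2 d, infinite_set d & block e b `&` d = set0) -> False.
    move=> Vb [d id bd0]; apply: id; apply: sub_finite_set (cof b (or_intror Vb)).
    by move=> n dn bn; have : (block e b `&` d) n by []; rewrite bd0.
  exfalso; have [Va|Vna] := in_ultra_setVsetC a uV.
    apply: (bad a Va); exists [set n | ~~ odd n]; first exact: evens_infinite.
    by rewrite unblockK //; apply/seteqP; split=> // n [/= + /negP].
  apply: (bad _ Vna); exists [set n | odd n]; first exact: odds_infinite.
  apply/seteqP; split=> // n [[k nak nk] /= on]; apply: nak.
  by exists n.
- apply: contrapT => no.
  (* If the claim fails, the union of the intervals missing [v] meets each member of [Q] infinitely
     often; then two disjoint quotients lie in one filter. *)
  pose d := block e v.
  have Sa : S (unblock e (~` d)).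
    left=> q Qq fa; apply: no; exists q => //.
    apply: sub_finite_set (block_finite he fa) => n [[k qk nk] ndn].
    by exists k => //; split=> //; exists n.
  have : (block e @` S) (block e v `&` block e (unblock e (~` d))).
    by apply: filterI; [exists v => //; right|exists (unblock e (~` d))].
  rewrite unblockK // setICr; exact: filter_not_empty.
- exfalso; have [q Qq iq] := Qbig e he.
  (* The blocks missed by [q] split into two infinite sets. Members of [S] with these quotients meet
     [q] finitely, so both are in [V], yet they are almost disjoint. *)
  pose d0 := ~` block e q; have [fI rf] := is_enum_enumeration iq.
  pose d i := [set (enumeration d0) (n.*2 + i)%N | n in [set: nat]].
  have dI (i : bool) : infinite_set (d i).
    by apply: range_incr_infinite => m n mn; apply: fI; rewrite ltn_add2r ltn_double.
  have dV (i : bool) : exists2 a, V a & block e a = d i.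
    have [a [aQ|Va] ea] := full _ (dI i); last by exists a.
    exfalso; apply: (aQ q Qq); apply: (block_disjoint he).
    rewrite ea; apply/seteqP; split=> // k [[n _ <-] bk].
    have : range (enumeration d0) (enumeration d0 (n.*2 + i)) by exists (n.*2 + i).
    by rewrite rf; apply.
  have [a Va ea] := dV true; have [b Vb eb] := dV false.
  apply: (Vinf _ (filterI Va Vb)); apply: (block_disjoint he).
  rewrite ea eb; apply/seteqP; split=> // k [[m _ <-] [n _]] /(incn_inj (incr_leq fI)).
  by move=> /(congr1 odd); rewrite !oddD !odd_double.
Qed.

(** * The topology of P(omega) *)

Lemma nbhs_cantorP (f : cantor_space) (N : set cantor_space) :
  nbhs f N <-> exists l, forall g, (forall i, i < l -> g i = f i) -> N g.
Proof.
split=> [|[l]].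
  pose F : set_system cantor_space := [set M : set cantor_space |
    exists l, forall g : cantor_space, (forall i, i < l -> g i = f i) -> M g].
  have FF : Filter F.
    split; first by exists 0.
    - move=> A B [l lA] [m mB]; exists (maxn l m) => g gf.
      by split; [apply: lA|apply: mB] => i im; apply: gf; rewrite leq_max im ?orbT.
    - by move=> A B AB [l lA]; exists l => g /lA /AB.
  (* The product topology is a supremum, so convergence of [F] may be checked one coordinate at a
     time. *)
  suff : F --> f by apply.
  apply/cvg_sup => i A.  rewrite nbhsE => -[B [[C oC <-] Cf] BA].
  by exists i.+1 => g gf; apply: BA; rewrite /= gf.
elim: l N => [|l IH] N lN; first by apply: (filterS _ (@filterT _ (nbhs f) _)) => g _; exact: lN.
have /IH nl : forall g : cantor_space, (forall i, i < l -> g i = f i) ->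
  [set g : cantor_space | forall i, i < l -> g i = f i] g by [].
have nl1 : nbhs f [set g : cantor_space | g l = f l].
  apply: (@proj_continuous _ (fun=> bool) l f [set b | b = f l]).
  exact: (discrete_set1 (f l)).
apply: filterS (filterI nl nl1) => g [gl gl1]; apply: lN => i.
by rewrite ltnS leq_eqVlt => /orP[/eqP->|/gl].
Qed.

Definition agree l (a b : set nat) := forall i, i < l -> (a i <-> b i).

Lemma nbhs_PomegaP (a : Pomega) (N : set Pomega) :
  nbhs a N <-> exists l, forall b : Pomega, agree l a b -> N b.
Proof.
rewrite nbhsE; split=> [[B [[C oC <-] Ca] BN]|[l lN]].
  have /nbhs_cantorP[l lC] : nbhs (charf a) C by apply: open_nbhs_nbhs.
  exists l => b ab; apply: BN => /=; apply: lC => i /ab abi.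
  by apply/asbool_equiv_eq; rewrite abi.
exists (charf @^-1` [set g : cantor_space | forall i, i < l -> g i = charf a i]).
  split=> //; exists [set g : cantor_space | forall i, i < l -> g i = charf a i] => //.
  rewrite openE => g gl; apply/nbhs_cantorP; exists l => h hg i il.
  by rewrite hg ?gl.
move=> b bl; apply: lN => i /bl e.
have e' : `[< (b : set nat) i >] = `[< (a : set nat) i >] := e.
by split=> H; apply/asboolP; [rewrite e'|rewrite -e']; exact/asboolP.
Qed.

Lemma nbhs_set_typeP (A : set Pomega) (a : set_type A) (N : set (set_type A)) :
  nbhs a N <->
  exists l, forall b : set_type A, agree l (set_val a) (set_val b) -> N b.
Proof.
split=> [|[l lN]].
  rewrite nbhsE => -[B [[C oC <-] Ca] BN].
  have /nbhs_PomegaP[l lC] : nbhs (set_val a) C by apply: open_nbhs_nbhs.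
  by exists l => b /lC /BN.
rewrite nbhsE; exists (set_val @^-1` [set b : Pomega | agree l (set_val a) b]).
  split=> //; exists [set b : Pomega | agree l (set_val a) b] => //.
  rewrite openE => b ab; apply/nbhs_PomegaP; exists l => c bc i il.
  exact: iff_trans (ab i il) (bc i il).
by move=> b /lN.
Qed.

Lemma is_enum_uniq a f g : is_enum a f -> is_enum a g -> f = g.
Proof.
suff le f' g' : is_enum a f' -> is_enum a g' ->
    forall n, (forall m, m < n -> f' m = g' m) -> f' n <= g' n.
  move=> fa ga; apply/funext; elim/ltn_ind => n IH; apply/eqP.
  by rewrite eqn_leq !le // => m mn; rewrite IH.
move=> [fI rf] [gI rg] n IH; have : range g' (g' n) by exists n.
rewrite rg -rf => -[m _ fg]; rewrite -fg leqNgt (incr_ltn fI); apply/negP => mn.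
move: fg; rewrite IH // => /(incn_inj (incr_leq gI)) e.
by rewrite e ltnn in mn.
Qed.

Lemma enumeration_range f : {homo f : m n / m < n} -> enumeration (range f) = f.
Proof.
move=> fI; apply: is_enum_uniq (_ : is_enum (range f) f) => //.
by apply: is_enum_enumeration; exact: range_incr_infinite.
Qed.

Lemma enumeration_incr a : infinite_set a -> {homo enumeration a : m n / m < n}.
Proof. by move=> /is_enum_enumeration[]. Qed.

Lemma enumeration_in a n : infinite_set a -> a (enumeration a n).
Proof.
move=> /is_enum_enumeration[_ ra].
by have : range (enumeration a) (enumeration a n) by []; rewrite ra.
Qed.

Lemma enumeration_le a n k : infinite_set a -> a k ->
  (forall m, m < n -> enumeration a m < k) -> enumeration a n <= k.
Proof.
move=> ia; have [aI ra] := is_enum_enumeration ia.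
rewrite -{1}ra => -[m _ <-] mk; rewrite (incr_leq aI) leqNgt; apply/negP => /mk.
by rewrite ltnn.
Qed.

(** * Compactness and concentration on the finite sets *)

(** For each [k], the complement of [K] and the sets of [g] with [g j] for some fixed [j] at least
    [k] cover the compact Cantor cube; a finite subcover yields [c k]. *)
Lemma closed_infsets_bounded (K : set Pomega) : closed K -> K `<=` infsets ->
  exists c : nat -> nat, forall a : set nat, K a -> forall k, exists2 j, a j & k <= j <= c k.
Proof.
move=> /closed_openC[C oC CK] Kinf.
suff /choice[c cP] k : exists c, forall a : set nat, K a -> exists2 j, a j & k <= j <= c.
  by exists c => a Ka k; exact: cP.
have := cantor_space_compact; rewrite compact_cover => cc.
have [|g _|D _ cD] := cc nat setT (fun j => C `|` [set g : cantor_space | g j && (k <= j)]).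
- move=> j _; apply: openU => //; rewrite openE => g /andP[gj kj].
  by apply/nbhs_cantorP; exists j.+1 => h hg /=; rewrite hg // gj.
- pose a : Pomega := [set i | g i].
  have ag : charf a = g.
    by apply/funext => i; rewrite /charf /a /=; case: (g i); [exact: asboolT|exact: asboolF].
  have [Ka|nKa] := pselect (K a).
    have /infinite_natP/(_ k)[j kj aj] := Kinf a Ka.
    by exists j => //; right; rewrite /= kj andbT.
  by exists 0 => //; left; have : (~` K) a by []; rewrite -CK /= ag.
have /finite_natP[c cP] := finite_fset D.
exists c => a Ka; have [j jD [Cj|/andP[aj kj]]] := cD (charf a) I.
  by have : (~` K) a by rewrite -CK.
by exists j; [exact/asboolP|rewrite kj ltnW //; exact: cP].
Qed.

(** Iterating a monotone majorant of [c] bounds each element of [a] in terms of the previous one,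
    uniformly in [a]. *)
Lemma meets_enumeration_bounded (c : nat -> nat) : exists G : nat -> nat,
  forall a : set nat, infinite_set a -> (forall k, exists2 j, a j & k <= j <= c k) ->
  forall n, enumeration a n <= G n.
Proof.
have [g gm cg] := runmax c.
pose G n := iter n (fun k => g k.+1) (g 0).
exists G => a ia ac; elim=> [|n IH].
  have [j aj /andP[_ jc]] := ac 0.
  by apply: leq_trans (leq_trans jc (cg 0)); exact: enumeration_le.
have [j aj /andP[nj jc]] := ac (enumeration a n).+1.
apply: (@leq_trans j).
  apply: enumeration_le => // m; rewrite ltnS => mn; apply: leq_trans nj.
  by rewrite ltnS (incr_leq (enumeration_incr ia)).
by apply: leq_trans jc _; apply: leq_trans (cg _) _; apply: gm.
Qed.

(** The complement of an open set including [Fin] is a closed set of infinite sets, so one function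
    bounds all enumerations of its members; only the small exceptional set can contain them. *)
Lemma meager_unbounded_concentrated (X : set Pomega) :
  meager_unbounded X -> concentrated bb (X `|` Fin) Fin.
Proof.
move=> [bX muX]; split=> [a Fa||V oV FV]; first by right.
  by apply: card_le_trans bX _; apply: subset_card_le => a Xa; left.
have [|a Va|c cP] := @closed_infsets_bounded (~` V).
- by rewrite closedC.
- by apply: contrapT => /contrapT /FV.
have [G GP] := meets_enumeration_bounded c.
have [g gm Gg] := runmax G.
(* Exceeding [G] everywhere makes the comparison set of a bounded point empty, hence no member of
   [S]; the summand [n] makes the function strictly increasing. *)
have betaI : {homo (fun n => n + (g n).+1) : m n / m < n}.
  by move=> m n mn; have := gm _ _ (ltnW mn); lia.
have [S [A [[[_ Sinf _] _] _ /card_ltP sA AP]]] :=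
  muX _ (range_incr_infinite betaI).
apply/card_ltP => bV; apply: sA; apply: card_le_trans bV _; apply: subset_card_le.
move=> a [[Xa|Fa] nVa]; last by case: nVa; exact: FV.
apply: contrapT => nAa; have /AP/Sinf/infinite_natP/(_ 0)[n _] : (X `\` A) a by [].
have ia : infinite_set (a : set nat) by move=> /FV.
rewrite /= enumeration_range // leqNgt => /negP; apply.
by have := GP a ia (cP a nVa) n; have := Gg n; lia.
Qed.

(** The sets avoiding some interval from [k] to [f (maxn k m)] form an open set including [Fin]. An
    infinite [x] bounded by [f] from [m] on lies outside it, since its element of index [maxn k m]
    falls in that interval. *)
Lemma concentrated_small (X : set Pomega) (f : nat -> nat) : X `<=` infsets ->
  concentrated bb (X `|` Fin) Fin ->
  ~ (bb #<= [set x | X x /\ le_star (enumeration x) f]).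
Proof.
move=> Xinf [_ _ cX].
pose B m := [set x | X x /\ forall n, m <= n -> enumeration x n <= f n].
have -> : [set x | X x /\ le_star (enumeration x) f] = \bigcup_m B m.
  apply/seteqP; split=> [x [Xx /le_starP[m mP]]|x [m _ [Xx mP]]]; first by exists m.
  by split=> //; apply/le_starP; exists m.
apply: not_bb_le_bigcup => m.
pose V : set Pomega := [set a | exists k, forall j, k <= j <= f (maxn k m) -> ~ (a : set nat) j].
have [||_ nV] := cX V.
- rewrite openE => a [k ka]; apply/nbhs_PomegaP; exists (f (maxn k m)).+1 => b ab.
  exists k => j jk bj; apply: (ka j jk); apply/(ab j) => //.
  by case/andP: jk.
- move=> a /finite_natP[k ka]; exists k => j /andP[kj _] /ka.
  by rewrite ltnNge kj.
apply: contra_not nV => /card_le_trans; apply; apply: subset_card_le => x [Xx xm].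
have ix := Xinf x Xx.
split=> [|[k kx]]; first by left.
apply: (kx (enumeration x (maxn k m))); last exact: enumeration_in.
rewrite (leq_trans _ (incr_ge (enumeration_incr ix) _)) ?leq_maxl //=.
by apply: xm; exact: leq_maxr.
Qed.

Lemma concentrated_bb_le (X : set Pomega) :
  concentrated bb (X `|` Fin) Fin -> bb #<= X.
Proof.
move=> [_ bXF _]; apply: contrapT => nX.
pose B (m : nat) := if m is 0 then X else Fin.
apply: (@not_bb_le_bigcup _ B); last first.
  apply: card_le_trans bXF _; apply: subset_card_le => a [Xa|Fa].
    by exists 0.
  by exists 1.
case=> [//|m]; apply: not_bb_le_countable.
have : countable [set A : set nat | A `<=` setT /\ finite_set A].
  exact: countable_finite_subset.
by apply: sub_countable; apply: subset_card_le => a.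
Qed.

(** * Meager semifilters *)

(** The semifilters of Talagrand's characterization: they are meager, and every meager semifilter is
    included in one of them. *)
Definition meets_almost_all (e : nat -> nat) : set Pomega :=
  [set a | finite_set (~` block e a)].

Lemma meets_almost_all_meager e : {homo e : m n / m < n} ->
  meager_semifilter (meets_almost_all e).
Proof.
move=> he; have blockT : block e setT = setT.
  by apply/seteqP; split=> // n _; exists (e n); rewrite // leqnn he.
split; first split.
- by exists (setT : set nat); rewrite /meets_almost_all /= blockT setCT.
- move=> a fa /(block_finite he) fb; apply: infinite_nat.
  by rewrite -(setUv (block e a)) finite_setU.
- move=> a b fa _ fab; apply: (@sub_finite_set _ _
      ((~` block e a) `|` (block e a `\` block e b))); last first.
    by rewrite finite_setU; split=> //; exact: block_finiteD.
  by move=> n nb; have [na|] := pselect (block e a n); [right|left].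
pose F m := [set a : set_type infsets | forall n, m <= n -> block e (set_val a) n].
exists F; split=> [m|]; last first.
  apply/seteqP; split=> [a /finite_natP[m ma]|a [m _ ma]].
    by exists m => // n mn; apply: contrapT => /ma; rewrite ltnNge mn.
  apply/finite_natP; exists m => n nb; rewrite ltnNge; apply/negP => mn.
  by apply: nb; exact: ma.
apply/seteqP; split=> // a /nbhs_set_typeP[l lF].
pose n := maxn m l.
(* [b] follows [a] below [l], skips block [n], and is full afterwards so as to be infinite. *)
pose b : Pomega := [set k | (set_val a : set nat) k /\ k < l \/ e n.+1 <= k].
have ib : infsets b.
  by apply/infinite_natP => N; exists (maxn N (e n.+1)); [exact: leq_maxl|right; exact: leq_maxr].
pose b' : set_type infsets := SigSub (mem_set ib).
have en1 : l <= e n by apply: leq_trans (incr_ge he _); exact: leq_maxr.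
have /lF : agree l (set_val a) (set_val b').
  move=> i il; split=> [ai|[[]//|]]; first by left.
  by rewrite leqNgt (leq_trans il) // (leq_trans en1) // ltnW // he.
move=> /(_ [set c | agree (e n.+1) b (set_val c)])[|c [Fc bc]].
  by apply/nbhs_set_typeP; exists (e n.+1).
have [k ck /andP[nk kn]] := Fc n (leq_maxl _ _).
have /(bc k kn) [[_ kl]|] := ck; first by have := leq_trans en1 nk; rewrite leqNgt kl.
by rewrite leqNgt kn.
Qed.

Definition cylinder (s : seq bool) (a : set nat) :=
  forall i, i < size s -> (a i <-> nth false s i).

Lemma cylinder_catl s t a : cylinder (s ++ t) a -> cylinder s a.
Proof.
move=> sta i si; have := sta i; rewrite size_cat nth_cat si; apply.
exact: leq_trans si (leq_addr _ _).
Qed.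

Lemma nowhere_dense_extension (G : set (set_type infsets)) s : nowhere_dense G ->
  exists t, forall a : set_type infsets, cylinder (s ++ t) (set_val a) -> ~ G a.
Proof.
move=> ndG.
(* Padding with ones keeps the point inside the space of infinite sets. *)
pose a0 : Pomega := [set i | nth false s i \/ size s <= i].
have ia0 : infsets a0.
  by apply/infinite_natP => N; exists (maxn N (size s)); [exact: leq_maxl|right; exact: leq_maxr].
pose a0' : set_type infsets := SigSub (mem_set ia0).
have sa0 : cylinder s a0.
  by move=> i si; split=> [[//|]|]; [rewrite leqNgt si|left].
have [a [sa nGa]] : exists a : set_type infsets,
    cylinder s (set_val a) /\ ~ closure G a.
  apply: contrapT => no.
  have : interior (closure G) a0'.
    apply/nbhs_set_typeP; exists (size s) => b a0b; apply: contrapT => nGb.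
    by apply: no; exists b; split=> // i si; rewrite -(a0b i si); exact: sa0.
  by rewrite ndG.
have [l lG] : exists l, forall b : set_type infsets,
    agree l (set_val a) (set_val b) -> ~ G b.
  apply: contrapT => no; apply: nGa => N /nbhs_set_typeP[l lN].
  apply: contrapT => GN; apply: no; exists l => b /lN Nb Gb; apply: GN.
  by exists b.
exists (mkseq (fun i => `[< (set_val a : set nat) (size s + i) >]) l) => b stb.
apply: lG => i il; have [si|si] := ltnP i (size s).
  rewrite (sa i si); apply: iff_sym; exact: (cylinder_catl stb).
have il' : i - size s < l by exact: leq_ltn_trans (leq_subr _ _) il.
have := stb i; rewrite size_cat size_mkseq nth_cat (ltnNge i (size s)) si /= nth_mkseq //.
rewrite subnKC // => H; apply: iff_sym; apply: iff_trans (H _) _.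
  by rewrite (leq_trans il) ?leq_addl.
by split=> /asboolP.
Qed.

(** The requirements in [L] are met one after another; lengthening [t] preserves those already
    met. *)
Lemma nowhere_dense_extensions (F : nat -> set (set_type infsets))
    (L : seq (seq bool * nat)) : (forall m, nowhere_dense (F m)) ->
  exists t, forall p, p \in L ->
    forall a : set_type infsets, cylinder (p.1 ++ t) (set_val a) -> ~ F p.2 a.
Proof.
move=> ndF; elim: L => [|[s m] L [t tP]]; first by exists [::].
have [t' t'P] := nowhere_dense_extension (s ++ t) (ndF m).
exists (t ++ t') => p; rewrite inE => /orP[/eqP-> a /=|pL a].
  by rewrite catA; exact: t'P.
by rewrite catA => c; apply: (tP p pL a); exact: cylinder_catl c.
Qed.

(** Each interval of [d] carries a pattern that, after any initial segment, leads out of the first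
    nowhere dense sets. If [a] missed infinitely many intervals, writing the patterns there would
    give a superset of [a] outside every [F m]. *)
Lemma meager_semifilter_meets (S : set Pomega) : meager_semifilter S ->
  exists2 d : nat -> nat, {homo d : m n / m < n} &
    S `<=` meets_almost_all d.
Proof.
move=> [[_ Sinf Sup] [F [ndF SF]]].
have /choice[tau tauP] (p : nat * nat) : exists t, 0 < size t /\
    forall s, size s = p.2 -> forall m, m <= p.1 ->
    forall a : set_type infsets, cylinder (s ++ t) (set_val a) -> ~ F m a.
  case: p => n d /=.
  have [t tP] := nowhere_dense_extensions
    [seq (val s, m) | s <- enum {: d.-tuple bool}, m <- iota 0 n.+1] ndF.
  (* The extra entry makes the pattern nonempty, so that [d] increases strictly. *)
  exists (rcons t false); split=> [|s sd m mn a]; first by rewrite size_rcons.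
  rewrite -cats1 catA => c.
  apply: (tP (s, m) _ a (cylinder_catl c)); apply/allpairsP; have sd' : size s == d by apply/eqP.
  by exists (Tuple sd', m); rewrite mem_enum mem_iota.
pose d := fix d n := if n is n'.+1 then d n' + size (tau (n', d n')) else 0.
have dI : {homo d : m n / m < n}.
  apply: homo_ltn => [y x z|n /=]; first exact: ltn_trans.
  by have [+ _] := tauP (n, d n); rewrite -{2}[d n]addn0 ltn_add2l.
exists d => // a Sa; apply: contrapT => /infinite_natP inf.
pose a' : Pomega := [set k | (a : set nat) k \/ exists2 n, ~ block d a n &
  d n <= k < d n.+1 /\ nth false (tau (n, d n)) (k - d n)].
have ia' : infsets a'.
  by have := Sinf a Sa; apply: sub_infinite_set => k ak; left.
have Sa' : S a'.
  apply: (Sup a) => //; have -> : (a : set nat) `\` a' = set0; last exact: finite_set0.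
  by apply/seteqP; split=> // k [ak]; apply; left.
have [m _ Fm] : (\bigcup_n F n) (SigSub (mem_set ia')) by rewrite -SF.
have [n mn nb] := inf m.
have [_ /(_ (mkseq (fun i => `[< (a' : set nat) i >]) (d n)) _ m mn _ _ Fm)] := tauP (n, d n).
apply; first by rewrite size_mkseq.
move=> i; rewrite size_cat size_mkseq => idn1; rewrite nth_cat size_mkseq.
have [idn|dni] := ltnP i (d n).
  by rewrite nth_mkseq //; split=> /asboolP.
have bi : d n <= i < d n.+1 by rewrite dni.
split=> [[ai|[n' _ [n'i]]]|ti]; last by right; exists n.
  by case: nb; exists i.
by rewrite (block_uniq dI n'i bi).
Qed.

(** * Concentrated sets are meager-unbounded *)

(* [V]-almost every interval of [h] contains at most one value of [m], so it
   misses either the even- or the odd-indexed values. *)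
Lemma evens_or_odds_sparse (V : set_system nat) (h m : nat -> nat) :
  UltraFilter V -> {homo h : i j / i < j} ->
  (forall c, V c -> exists2 l, c l & forall n, h n <= l < h n.+1 ->
    forall i j, i < j -> h n <= m i -> ~ (m j < h n.+1)) ->
  {homo m : i j / i < j} ->
  exists i : bool, exists2 v, V v &
    block h v `&` block h (range (fun j => m (j.*2 + i))) = set0.
Proof.
move=> uV hI sparse mI; apply: contrapT => no.
pose v (i : bool) : set nat := [set l | forall n, h n <= l < h n.+1 ->
  ~ block h (range (fun j => m (j.*2 + i))) n].
have nVv i : V (~` v i).
  have [Vvi|//] := in_ultra_setVsetC (v i) uV.
  exfalso; apply: no; exists i, (v i) => //; apply/seteqP; split=> // n [[l vl nl]].
  exact: vl.
have [l [/existsNP[n0 /not_implyP[n0l /contrapT b0]]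
         /existsNP[n1 /not_implyP[n1l /contrapT b1]]] lsp] :=
  sparse _ (filterI (nVv false) (nVv true)).
rewrite (block_uniq hI n1l n0l) in b1.
have [_ [j _ <-] /andP[nj jn]] := b0; have [_ [j' _ <-] /andP[nj' jn']] := b1.
have [lt_jj'|] := ltnP (j.*2 + false) (j'.*2 + true); first exact: lsp n0l _ _ lt_jj' nj jn'.
rewrite leq_eqVlt => /orP[/eqP/(congr1 odd)|lt_j'j]; first by rewrite !oddD !odd_double.
exact: lsp n0l _ _ lt_j'j nj' jn.
Qed.

Lemma concentrated_meager_unbounded (X : set Pomega) : semifilter_trichotomy ->
  X `<=` infsets -> concentrated bb (X `|` Fin) Fin -> meager_unbounded X.
Proof.
move=> tri Xinf cX; split; first exact: concentrated_bb_le.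
move=> b ib; apply: contrapT => nb.
have small f := concentrated_small (f := f) Xinf cX.
pose en (x : Pomega) := enumeration x.
have enI x : X x -> {homo en x : m n / m < n} by move=> /Xinf; exact: enumeration_incr.
pose Q (x : Pomega) : set nat := [set n | en b n <= en x n].
(* The failure at [b] is tested against the semifilter [meets_almost_all e] and the small set of
   points bounded by [t]. *)
have bad t (e : nat -> nat) : {homo e : m n / m < n} -> exists x : Pomega,
    [/\ X x, ~ le_star (en x) t & infinite_set (~` block e (Q x))].
  move=> he; apply: contrapT => no; apply: nb.
  exists (meets_almost_all e), [set x | X x /\ le_star (en x) t]; split.
  - exact: meets_almost_all_meager.
  - by move=> x [].
  - by apply/card_ltP; exact: small.
  - move=> x [Xx nt]; apply: contrapT => fQ; apply: no; exists x; split=> //.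
    by move=> xt; apply: nt.
have [T [lt [u idx]]] := exists_bounding_index.
have [_ tr tot _ _] := idx.
have [V [w [uV Vinf Vw Vbase]]] := small_base_ultrafilter idx tri.
(* [Psi t] packs the partition and the points found for the bound [t], with a dummy value when [t]
   is not above [en b]. *)
have /choice[Psi PsiP] (t : nat -> nat) : exists p : (nat -> nat) * (T -> Pomega),
    le_star (en b) t -> {homo p.1 : m n / m < n} /\ forall y,
    [/\ X (p.2 y), ~ le_star (en (p.2 y)) t &
        finite_set (block p.1 (Q (p.2 y)) `\` block p.1 (w y))].
  have [bt|nbt] := pselect (le_star (en b) t); last by exists (id, fun=> b).
  have [||h hI hV] := @coherent_with_ultrafilter V
    [set q | exists2 x, X x /\ ~ le_star (en x) t & q = Q x] tri uV Vinf.
  - move=> _ [x [Xx nxt] ->] /finite_natP[N NP]; apply: nxt; apply: le_star_trans bt.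
    apply/le_starP; exists N => n Nn; rewrite leqNgt; apply/negP => /ltnW /NP.
    by rewrite ltnNge Nn.
  - by move=> e /(bad t)[x [Xx nxt ix]]; exists (Q x) => //; exists x.
  have /choice[x xP] y : exists x, [/\ X x, ~ le_star (en x) t &
      finite_set (block h (Q x) `\` block h (w y))].
    by have [_ [x [Xx nxt] ->] fx] := hV (w y) (Vw y); exists x.
  by exists (h, x) => _; split.
have [t tP] := tower_rec idx (fun _ ty z => en ((Psi ty).2 z)) (en b).
pose h x := (Psi (t x)).1; pose xi x y := (Psi (t x)).2 y.
have bt x : le_star (en b) (t x) by case: (tP x).
have hI x : {homo h x : m n / m < n} by case: (PsiP _ (bt x)).
have xiP x y : [/\ X (xi x y), ~ le_star (en (xi x y)) (t x) &
    finite_set (block (h x) (Q (xi x y)) `\` block (h x) (w y))].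
  by have [_] := PsiP _ (bt x); apply.
have /choice[nu nuP] (yk : T * nat) : exists l, w yk.1 l /\ yk.2 <= l.
  by have /infinite_natP/(_ yk.2)[l] := Vinf _ (Vw yk.1); exists l.
(* [f x y k] bounds the right end of the interval of [h x] containing a chosen element of [w y]
   beyond [h x k.+1]. *)
pose f x y k := h x (nu (y, h x k.+1)).+1.
have [D DP] := tower_rec idx (fun x _ y => f x y) (fun=> 0).
have [p0 p0P] := non_dominating idx D tri.
have [p pm p0p] := runmax p0.
have pf x y N : exists2 k, N <= k & f x y k < p k.
  apply: contrapT => no; have [z xz yz] := index_directed idx x y.
  apply: (p0P z); have [_ _ /(_ x xz)[_ /(_ y yz)]] := DP z; apply: le_star_trans.
  apply/le_starP; exists N => k Nk; rewrite leqNgt; apply/negP => fk.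
  by apply: no; exists k => //; exact: leq_trans (p0p k).
(* When [f x y k < p k], the interval of [h x] around the chosen element ends before two rungs can
   fit into it. *)
pose m := ladder p; have mI : {homo m : i j / i < j} by exact: ladder_incr.
pose e (i : bool) : set nat := range (fun j => m (j.*2 + i)).
have good x : exists i : bool, exists2 v, V v & block (h x) v `&` block (h x) (e i) = set0.
  apply: evens_or_odds_sparse => // c Vc.
  have [y /finite_natP[M wM]] := Vbase c Vc.
  have [k Mk fk] := pf x y M.
  have [j /andP[jk kj]] := ex_block mI (leq0n k).
  have [/= wl kl] := nuP (y, h x k.+1); set l := nu _ in wl kl.
  have kl' : k < l by exact: leq_trans (incr_ge (hI x) _) kl.
  exists l.
    apply: contrapT => ncl; have := wM l (conj wl ncl).
    by rewrite ltnNge (leq_trans Mk) // ltnW.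
  move=> n /andP[nl ln] i i' ii' ni; apply/negP; rewrite -leqNgt.
  have kn : k < n by rewrite -ltnS -(incr_ltn (hI x)); exact: leq_ltn_trans kl ln.
  have ji : j < i.
    rewrite -(incr_ltn mI); apply: leq_ltn_trans jk _; apply: leq_trans ni.
    exact: leq_trans kn (incr_ge (hI x) _).
  apply: (@leq_trans (f x y k)).
    by rewrite /f -/l (incr_leq (hI x)) ltnS; exact: leq_trans (incr_ge (hI x) _) nl.
  apply: leq_trans (ltnW fk) _; apply: (@leq_trans (m j.+2)).
    by rewrite /m ladderS; apply: leqW; apply: leq_trans (leq_addl _ _); apply/pm/ltnW.
  by rewrite (incr_leq mI); lia.
pose good_for x (i : bool) := exists2 v, V v & block (h x) v `&` block (h x) (e i) = set0.
have [i cofi] : exists i, forall x, exists2 z, lt x z & good_for z i.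
  (* If parity [false] fails beyond some [x0], then parity [true] succeeds everywhere beyond it. *)
  have [|/existsNP[x0 nx0]] :=
    pselect (forall x, exists2 z, lt x z & good_for z false); first by exists false.
  exists true => x; have [z xz x0z] := index_directed idx x x0.
  by exists z => //; have [[] // gz] := good z; case: nx0; exists z.
pose phi k := en b (m (k.*2 + i)).
pose B := [set x | X x /\ le_star (en x) phi].
(* A point may be [xi x' y'] for several pairs; [al z] lies above both indices of one chosen
   pair. *)
have /choice[al alP] z : exists x, (exists x' y', z = xi x' y') ->
    exists x' y', [/\ lt x' x, lt y' x & z = xi x' y'].
  have [[x' [y' zE]]|no] := pselect (exists x' y', z = xi x' y').
    by have [x x'x y'x] := index_directed idx x' y'; exists x; exists x', y'.
  have [x0 _] : exists x : T, True.
    apply: contrapT => noT; apply: (index_unbounded idx).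
    by exists (fun=> 0) => x; exfalso; apply: noT; exists x.
  by exists x0.
have [x0 x0P] : exists x, forall c, (al @` B) c -> lt c x.
  apply: (small_lt_bounded idx) => bC; apply: (small phi).
  exact: card_le_trans bC (card_image_le _ _).
have [x x0x [v Vv ve]] := cofi x0.
have [y wv] := Vbase v Vv; have [Xxi nxi Qw] := xiP x y.
have Qe : finite_set (Q (xi x y) `&` e i).
  apply: contrapT => /(block_infinite (hI x)); apply.
  apply: (@sub_finite_set _ _ ((block (h x) (Q (xi x y)) `\` block (h x) (w y)) `|`
      (block (h x) (w y) `\` block (h x) v))); last first.
    by rewrite finite_setU; split=> //; exact: block_finiteD.
  move=> n [k [Qk ek] nk]; have [wn|nwn] := pselect (block (h x) (w y) n).
    right; split=> // vn; have : (block (h x) v `&` block (h x) (e i)) n.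
      by split=> //; exists k.
    by rewrite ve.
  by left; split=> //; exists k.
have Bxi : B (xi x y).
  split=> //; have /finite_natP[N NP] := Qe; apply/le_starP; exists N => k Nk.
  have km : k <= m (k.*2 + i) by apply: leq_trans (incr_ge mI _); rewrite -addnn; lia.
  apply: (@leq_trans (en (xi x y) (m (k.*2 + i)))); first by rewrite (incr_leq (enI _ Xxi)).
  rewrite leqNgt; apply/negP => /ltnW bm.
  have := NP (m (k.*2 + i)); rewrite ltnNge (leq_trans Nk km) => /(_ _)/negP; apply=> //.
  by split=> //; exists k.
(* The chosen pair for [xi x y] lies below [al], which is below [x]; so the tower bounds this point
   by [t x], against [nxi]. *)
have [|x' [y' [x'a y'a xiE]]] := alP (xi x y); first by exists x, y.
have ax : lt (al (xi x y)) x by apply: tr x0x; apply: x0P; exists (xi x y).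
apply: nxi; have [_ _ /(_ _ ax)[+ _]] := tP x; apply: le_star_trans.
have [_ _ /(_ _ x'a)[_ /(_ _ y'a)]] := tP (al (xi x y)).
by rewrite -/(xi x' y') -xiE.
Qed.

(** * Products with Hurewicz spaces *)

(* A base in the weak sense that every neighbourhood of [y] includes a member
   containing [y]; the members need not be open. *)
Definition has_countable_base (Y : topologicalType) :=
  exists B : nat -> set Y, forall y O, nbhs y O -> exists2 i, B i y & B i `<=` O.

Lemma set_of_reals_countable_base (Y : topologicalType) :
  set_of_reals Y -> has_countable_base Y.
Proof.
move=> [_ [A [f [g [_ cg fK gK]]]]].
pose B i := [set y : Y | if @unpickle (seq bool) i is Some s
  then forall j, j < size s -> (set_val (f y) : cantor_space) j = nth false s j else False].
exists B => y O yO.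
have : nbhs (f y) (g @^-1` O) by apply: cg; rewrite fK.
rewrite nbhsE => -[_ [[C oC <-] Cf] CO].
have /nbhs_cantorP[l lC] : nbhs (set_val (f y) : cantor_space) C.
  by apply: open_nbhs_nbhs.
exists (pickle (mkseq (set_val (f y) : nat -> bool) l)).
  by rewrite /B /mkset pickleK size_mkseq => j jl; rewrite nth_mkseq.
move=> z; rewrite /B /mkset pickleK size_mkseq => zl.
have := CO (f z); rewrite /= fK; apply; apply: lC => j jl.
by rewrite zl // nth_mkseq.
Qed.

(** Covers of [Z] lift to cylinders. The section at [y0] recovers [W] from [lift W], so finite
    selections stay finite. *)
Lemma hurewicz_fst (Z Y : topologicalType) (y0 : Y) :
  hurewicz (Z * Y)%type -> hurewicz Z.
Proof.
move=> hZY U cU.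
pose lift (W : set Z) : set (Z * Y) := [set p | W p.1].
have [|G [GP GU]] := hZY (fun n => lift @` U n).
  move=> n; have [oU UT] := cU n; split=> [_ [W UW <-]|].
    rewrite openE => -[z y] Wz; exists (W, setT) => [|[z' y'] [] //].
    by split=> /=; [apply: open_nbhs_nbhs; split=> //; exact: oU|exact: filterT].
  apply/seteqP; split=> // -[z y] _; have : (\bigcup_(V in U n) V) z by rewrite UT.
  by move=> [W UW Wz]; exists (lift W) => //; exists W.
exists (fun n => [set W | U n W /\ G n (lift W)]); split=> [n|z].
  split=> [|W []//]; have [fG _] := GP n.
  apply: (@sub_finite_set _ _ ((fun W' => [set z | W' (z, y0)]) @` G n)).
    by move=> W [_ GW]; exists (lift W).
  exact: finite_image.
apply: filterS (GU (z, y0)) => n [V GV]; have [_ /(_ V GV)[W UW WV]] := GP n.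
by rewrite -WV in GV * => Wz; exists W.
Qed.

Section product.
Context (X : set Pomega) (Y : topologicalType).
Let Z := set_type (X `|` Fin).
Let elt (z : Z) : set nat := set_val z.

Let prod_nbhsP (z : Z) (y : Y) (W : set (Z * Y)) : nbhs (z, y) W ->
  exists l, \forall y' \near y, forall z', agree l (elt z) (elt z') -> W (z', y').
Proof.
move=> [[P P'] /= [/nbhs_set_typeP[l lP] nP'] PW]; exists l.
by apply: filterS nP' => y' P'y' z' /lP Pz'; exact: PW.
Qed.

(** For each code of a basic box a member of [U] including the box is chosen. A code without one
    yields [set0], so membership in [U] is claimed only at the index covering [p]. *)
Let countable_subcover (U : set (set (Z * Y))) : has_countable_base Y ->
  open_cover U -> exists W : nat -> set (Z * Y),
    forall p, exists2 c, U (W c) & W c p.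
Proof.
move=> [B BP] [oU UT].
pose box (c : seq bool * nat) : set (Z * Y) :=
  [set p | cylinder c.1 (elt p.1) /\ B c.2 p.2].
pose W i := if unpickle i is Some c then xget set0 [set W | U W /\ box c `<=` W] else set0.
exists W => -[z y]; have : (\bigcup_(V in U) V) (z, y) by rewrite UT.
move=> [V UV Vzy]; have [|l lV] := @prod_nbhsP z y V.
  by apply: open_nbhs_nbhs; split=> //; exact: oU.
have [i By BV] := BP _ _ lV.
pose c := (mkseq (fun j => `[< elt z j >]) l, i).
have boxV : box c `<=` V.
  move=> [z' y'] /= [cz' /BV]; apply => j jl.
  have := cz' j; rewrite size_mkseq nth_mkseq // => /(_ jl) H.
  by apply: iff_sym; apply: iff_trans H _; split=> /asboolP.
have : [set W | U W /\ box c `<=` W] (W (pickle c)).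
  by rewrite /W pickleK; apply: xgetPex; exists V.
move=> [UW boxW]; exists (pickle c) => //; apply: boxW; split=> //= j.
by rewrite size_mkseq => jl; rewrite nth_mkseq //; split=> /asboolP.
Qed.

(* Over [O], a finite subfamily of [U] covers every [z] with a gap [k, l). *)
Let gap_covered (U : set (set (Z * Y))) k l (F : set (set (Z * Y))) (O : set Y) :=
  [/\ finite_set F, F `<=` U & forall z, (forall j, k <= j < l -> ~ elt z j) ->
    forall y, O y -> (\bigcup_(V in F) V) (z, y)].

Let gap_coveredU U k l l' F F' O O' : gap_covered U k l F O -> gap_covered U k l' F' O' ->
  gap_covered U k (maxn l l') (F `|` F') (O `|` O').
Proof.
move=> [fF FU FO] [fF' FU' FO']; split; first by rewrite finite_setU.
  by move=> V [/FU|/FU'].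
move=> z gz y [Oy|Oy].
  have [|V FV Vzy] := FO z _ y Oy; last by exists V => //; left.
  by move=> j /andP[kj jl]; apply: gz; rewrite kj leq_max jl.
have [|V FV Vzy] := FO' z _ y Oy; last by exists V => //; right.
by move=> j /andP[kj jl]; apply: gz; rewrite kj leq_max jl orbT.
Qed.

(** If [z] skips [k, l), it agrees below [l] with its trace on [k]. There are finitely many traces,
    all of them points of [Fin], and finitely many members of [U] cover these over a neighbourhood
    of [y]. *)
Let gap_open_cover (U : set (set (Z * Y))) k : open_cover U ->
  open_cover [set O | open O /\ exists l F, gap_covered U k l F O].
Proof.
move=> [oU UT]; split=> [V [oV _]|]; first exact: oV.
apply/seteqP; split=> // y _.
pose trace (s : {set 'I_k}) : Pomega := [set i | exists2 j : 'I_k, j \in s & val j = i].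
have ZT (s : {set 'I_k}) : (X `|` Fin) (trace s).
  by right; apply/finite_natP; exists k => _ [j _ <-]; exact: ltn_ord.
pose zs s : Z := SigSub (mem_set (ZT s)).
have /choice[Wl WlP] (s : {set 'I_k}) : exists Wl : set (Z * Y) * nat, U Wl.1 /\
    \forall y' \near y, forall z', agree Wl.2 (trace s) (elt z') -> Wl.1 (z', y').
  have : (\bigcup_(V in U) V) (zs s, y) by rewrite UT.
  move=> [V UV Vzy]; have [|l lV] := @prod_nbhsP (zs s) y V; last by exists (V, l).
  by apply: open_nbhs_nbhs; split=> //; exact: oU.
pose O := [set y' | forall s z', agree (Wl s).2 (trace s) (elt z') -> (Wl s).1 (z', y')].
have nO : nbhs y O by apply: filter_forall => s; case: (WlP s).
exists (interior O); last by [].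
split; first exact: open_interior.
exists (maxn k (\max_s (Wl s).2)), [set (Wl s).1 | s in [set: {set 'I_k}]]; split.
- by apply: finite_image; exact: finite_finset.
- by move=> _ [s _ <-]; case: (WlP s).
- move=> z gz y' /interior_subset Oy'.
  pose s := [set i : 'I_k | `[< elt z i >]]%SET.
  exists (Wl s).1; first by exists s.
  apply: Oy' => i iW; split=> [[j + <-]|zi]; first by rewrite inE => /asboolP.
  have [ik|ki] := ltnP i k; first by exists (Ordinal ik) => //; rewrite inE; exact/asboolP.
  exfalso; apply: (gz i) => //; rewrite ki leq_max.
  by rewrite (leq_trans iW (leq_bigmax (F := fun s => (Wl s).2) s)) orbT.
Qed.

Let gap_selection (U : nat -> set (set (Z * Y))) : hurewicz Y ->
  (forall n, open_cover (U n)) ->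
  exists (l : nat -> nat -> nat) (F : nat -> nat -> set (set (Z * Y))),
    (forall n k, finite_set (F n k) /\ F n k `<=` U n) /\
    forall y, exists N, forall n, N <= n -> forall k z,
      (forall j, k <= j < l n k -> ~ elt z j) -> (\bigcup_(V in F n k) V) (z, y).
Proof.
move=> hY cU; pose dec c := odflt (0, 0) (@unpickle (nat * nat)%type c).
pose cov n k := [set O | open O /\ exists l F, gap_covered (U n) k l F O].
have [|G [GP GY]] := hY (fun c => cov (dec c).1 (dec c).2).
  by move=> c; exact: gap_open_cover.
have /choice[lF lFP] (p : nat * nat) : exists lF : nat * set (set (Z * Y)),
    gap_covered (U p.1) p.2 lF.1 lF.2 (\bigcup_(O in G (pickle p)) O).
  have [fG] := GP (pickle p); rewrite /dec pickleK /=.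
  have /finite_seqP[s ->] := fG.
  elim: s => [_|O s IH Gs].
    by exists (0, set0); split=> //= z _ y [V].
  have [|lF1 P1] := IH; first by move=> O' sO'; apply: Gs; rewrite /= inE sO' orbT.
  have [|_ [l2 [F2 P2]]] := Gs O; first by rewrite /= inE eqxx.
  exists (maxn l2 lF1.1, F2 `|` lF1.2) => /=.
  have -> : \bigcup_(O' in [set` O :: s]) O' = O `|` \bigcup_(O' in [set` s]) O'.
    apply/seteqP; split=> [y [V]|y [Oy|[V sV Vy]]].
    - by rewrite /= inE => /orP[/eqP-> Oy|sV Vy]; [left|right; exists V].
    - by exists O => //=; rewrite inE eqxx.
    - by exists V => //=; rewrite inE; apply/orP; right.
  exact: gap_coveredU.
exists (fun n k => (lF (n, k)).1), (fun n k => (lF (n, k)).2); split=> [n k|y].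
  by have [] := lFP (n, k).
have [M _ MP] := GY y.
(* Beyond this value of [n] every pair [(n, k)] has a code at least [M], so all [k] are served at
   once. *)
exists (\max_(c < M) (dec c).1).+1 => n Nn k z gz.
have [_ _ /(_ z gz y)] := lFP (n, k); apply; apply: MP => /=.
rewrite leqNgt; apply/negP => cM; move: Nn.
have := leq_bigmax (F := fun c : 'I_M => (dec c).1) (Ordinal cM).
by rewrite /= /dec pickleK /= leqNgt => /negP.
Qed.

(* If each interval [h i, h i.+1) with j <= i <= 2j met [x], then [x] would have
   j + 1 elements below h(2j + 1). *)
Let skips_interval (x : set nat) (h : nat -> nat) j : infinite_set x ->
  {homo h : m n / m < n} -> h (j.*2.+1) <= enumeration x j ->
  exists2 i, j <= i < j.*2.+1 & forall k, h i <= k < h i.+1 -> ~ x k.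
Proof.
move=> ix hI hx; apply: contrapT => no.
have meet i : j <= i < j.*2.+1 -> exists2 k, x k & h i <= k < h i.+1.
  move=> ij; apply: contrapT => nk; apply: no; exists i => // k hk xk.
  by apply: nk; exists k.
have lth r : r <= j -> enumeration x r < h (j + r).+1.
  elim: r => [_|r IH rj].
    have [|k xk /andP[_ kh]] := meet j; first by rewrite leqnn /= ltnS -addnn leq_addr.
    by rewrite addn0; apply: leq_ltn_trans kh; exact: enumeration_le.
  have [|k xk /andP[hk kh]] := meet (j + r.+1); first by rewrite leq_addr /= ltnS -addnn leq_add2l.
  apply: leq_ltn_trans kh; apply: enumeration_le => // m; rewrite ltnS => mr.
  apply: leq_trans hk; rewrite addnS; apply: leq_ltn_trans (IH (ltnW rj)).
  by rewrite (incr_leq (enumeration_incr ix)).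
by have := lth j (leqnn j); rewrite addnn ltnNge hx.
Qed.

Lemma meager_unbounded_hurewicz : X `<=` infsets -> meager_unbounded X ->
  has_countable_base Y -> hurewicz Y -> hurewicz (Z * Y)%type.
Proof.
move=> Xinf [_ muX] cbY hY U cU.
have [l [F [FP FY]]] := gap_selection hY cU.
(* The interval of [h] starting at [h j] includes the gaps demanded at [h j] by all [n] up to
   [j]. *)
pose h := fix h j := if j is i.+1 then (h i + \max_(n < i.+1) l n (h i)).+1 else 0.
have hI : {homo h : m n / m < n}.
  by apply: homo_ltn => [y x z|n /=]; [exact: ltn_trans|rewrite ltnS leq_addr].
have lh n j : n <= j -> l n (h j) <= h j.+1.
  rewrite -ltnS => nj; apply: leqW; apply: leq_trans (leq_addl _ _).
  exact: (leq_bigmax (F := fun n : 'I_j.+1 => l n (h j)) (Ordinal nj)).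
(* This function is the threshold in [skips_interval]: a point above it at [j] skips an interval
   with index between [j] and [2j]. *)
have bI : {homo (fun j => h j.*2.+1) : m n / m < n}.
  by move=> m n mn; apply: hI; rewrite ltnS ltn_double.
have [S [A [muS AX sA AP]]] := muX _ (range_incr_infinite bI).
have [d dI dS] := meager_semifilter_meets muS.
have /choice[W WP] n : exists W : nat -> set (Z * Y), forall p, exists2 c, U n (W c) & W c p.
  exact: countable_subcover.
pose A' := [set z : Z | A (elt z)].
have sA' : ~ (bb #<= A').
  move/card_ltP: sA; apply: contra_not => /card_le_trans; apply.
  by rewrite -[A']/(set_val @^-1` A); apply: card_ge_preimage => a b _ _; exact: val_inj.
pose upto n m z := [set y | exists c, [/\ c <= m, U n (W n c) & W n c (z, y)]].
(* Hurewicz for [Y] is applied to the slice at [z]; the covers [upto] increase in [m], so one number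
   codes a finite selection. *)
have /choice[f fP] (z : Z) : exists f : nat -> nat, forall y,
    \forall n \near \oo, upto n (f n) z y.
  have [|G [GP GY]] := hY (fun n => range (fun m => upto n m z)).
    move=> n; split=> [_ [m _ <-]|].
      rewrite openE => y [c [cm UW Wy]]; have [oU _] := cU n.
      have [|k kW] := @prod_nbhsP z y (W n c).
        by apply: open_nbhs_nbhs; split=> //; exact: oU.
      by apply: filterS kW => y' y'W; exists c; split=> //; exact: y'W.
    apply/seteqP; split=> // y _; have [c UW Wc] := WP n (z, y).
    by exists (upto n c z); [exists c|exists c].
  have /choice[f fP] n : exists m, forall V, G n V -> V `<=` upto n m z.
    have [/finite_seqP[s ->] ] := GP n.
    elim: s => [_|V s IH Gs]; first by exists 0.
    have [|m mP] := IH; first by move=> V' sV'; apply: Gs; rewrite /= inE sV' orbT.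
    have [|m' _ Vm'] := Gs V; first by rewrite /= inE eqxx.
    exists (maxn m m') => V'; rewrite /= inE => /orP[/eqP->|/mP V'm] y.
      by rewrite -Vm' => -[c [cm UW Wy]]; exists c; rewrite leq_max cm orbT.
    by move=> /V'm[c [cm UW Wy]]; exists c; rewrite leq_max cm.
  by exists f => y; apply: filterS (GY y) => n [V GV Vy]; exact: fP Vy.
have [g gP] := small_bounded f sA'.
(* The first part serves skipped intervals: an index [j] in block [n] of [d] leads to one of index
   at most [2j], below [(d n.+1).*2]. The second part serves the small set [A']. *)
pose H n := (\bigcup_(j in `I_(d n.+1).*2) F n (h j)) `|`
  (W n @` `I_(g n).+1 `&` U n).
exists H; split=> [n|[z y]].
  split; last by move=> V [[j _]|[]//]; have [_] := FP n (h j); apply.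
  rewrite finite_setU; split.
    by apply: bigcup_finite => [|j _]; [exact: finite_II|case: (FP n (h j))].
  by apply: finite_setIl; apply: finite_image; exact: finite_II.
have [N NP] := FY y.
have skip : (\forall n \near \oo, exists2 j, n <= j < (d n.+1).*2 &
    forall k, h j <= k < h j.+1 -> ~ elt z k) ->
    \forall n \near \oo, (\bigcup_(V in H n) V) (z, y).
  have nearN : \forall n \near \oo, N <= n by exists N.
  move=> sk; apply: filterS2 sk nearN => n [j /andP[nj jd] jz] Nn.
  have [|V FV Vzy] := NP n Nn (h j) z.
    by move=> k /andP[hk kl]; apply: jz; rewrite hk (leq_trans kl) // lh.
  by exists V => //; left; exists j.
have [zA|znA] := pselect (A (elt z)).
  apply: filterS2 (gP z zA) (fP z y) => n fg [c [cf UW Wzy]].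
  by exists (W n c) => //; right; split=> //; exists c => //=; rewrite ltnS (leq_trans cf).
apply: skip; have [Xz|/finite_natP[M MP]] : (X `|` Fin) (elt z) by exact: set_valP.
  have /finite_natP[M MP] := dS _ (AP (elt z) (conj Xz znA)).
  exists M => // n /= Mn.
  have [j jb /andP[dj jd]] : block d [set n | enumeration (range (fun j => h j.*2.+1)) n <=
      enumeration (elt z) n] n.
    by apply: contrapT => /MP; rewrite ltnNge Mn.
  move: jb; rewrite /= (enumeration_range bI) => /(skips_interval (Xinf _ Xz) hI).
  case=> i /andP[ji ij] iz; exists i => //.
  rewrite (leq_trans _ ji) ?(leq_trans (incr_ge dI n)) //=.
  by lia.
(* A finite set skips every interval of [h] starting beyond it, so index [n] itself serves. *)
exists M => // n /= Mn; exists n.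
  by rewrite leqnn /= -addnn; have := incr_ge dI n.+1; lia.
move=> k /andP[hk _] /MP; rewrite ltnNge (leq_trans Mn) //.
exact: leq_trans (incr_ge hI n) hk.
Qed.

End product.

(** * The equivalence of the four statements *)

Lemma bool_countable_base : has_countable_base bool.
Proof.
exists (fun i => [set b | nat_of_bool b = i]) => b O /nbhs_singleton Ob.
by exists b => // b' /= e; have -> : b' = b by case: b' b e {Ob} => [] [].
Qed.

Lemma hurewicz_bool : hurewicz bool.
Proof.
move=> U cU; have /choice[W WP] (nb : nat * bool) : exists V, U nb.1 V /\ V nb.2.
  have [_ UT] := cU nb.1; have : (\bigcup_(V in U nb.1) V) nb.2 by rewrite UT.
  by move=> [V UV Vb]; exists V.
exists (fun n => [set W (n, b) | b in [set: bool]]); split=> [n|b].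
  split; first by apply: finite_image; exact: finite_finset.
  by move=> _ [b _ <-]; case: (WP (n, b)).
by exists 0 => // n _; exists (W (n, b)); [exists b|case: (WP (n, b))].
Qed.

Theorem theorem3p2 (trichotomy : semifilter_trichotomy)
    (X : set Pomega) (X_inf : X `<=` infsets) :
  [<-> concentrated bb (X `|` Fin) Fin;
       concentrated bb (X `|` Fin) Fin /\ hurewicz (set_type (X `|` Fin));
       concentrated bb (X `|` Fin) Fin /\
         productively_hurewicz (set_type (X `|` Fin));
       meager_unbounded X].
Proof.
tfae.
(* The product theorem is used with the two-point factor [bool] and then projected. *)
- move=> cX; split=> //; apply: (@hurewicz_fst _ bool true).
  apply: meager_unbounded_hurewicz => //; last exact: hurewicz_bool.
    exact: concentrated_meager_unbounded.
  exact: bool_countable_base.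
- move=> [cX _]; split=> // Y /set_of_reals_countable_base bY hY.
  by apply: meager_unbounded_hurewicz => //; exact: concentrated_meager_unbounded.
- by move=> [cX _]; exact: concentrated_meager_unbounded.
- exact: meager_unbounded_concentrated.
Qed.
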